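(* Let $\Omega\subset\mathbb R^d$ be convex and compact, let $y_0,y_1\in\Omega$, $a_0,a_1>0$, and $\mu_0=a_0\delta_{y_0}$, $\mu_1=a_1\delta_{y_1}$. (1) If $|y_0-y_1|\ne\pi/2$, there is exactly one geodesic curve in $(\mathcal M(\Omega),\mathsf{HK})$ connecting $\mu_0$ and $\mu_1$. (2) If $|y_0-y_1|=\pi/2$, the set of all geodesic curves connecting $\mu_0$ and $\mu_1$ is convex and contains uncountably many linearly independent elements; in particular its linear span is infinite-dimensional. (Here curves $[0,1]\to\mathcal M(\Omega)$ are regarded as elements of the vector space of maps from $[0,1]$ into the finite signed Borel measures on $\Omega$.)
   Context: $\mathcal M(\Omega)$ is the set of finite nonnegative Borel measures on $\Omega$. The cone over $\Omega$ is $\mathfrak C_\Omega:=(\Omega\times[0,\infty[)/(\Omega\times\{0\})$, with points $[x,r]$, and metric $\mathsf d_{\mathfrak C}([x_0,r_0],[x_1,r_1])^2=r_0^2+r_1^2-2r_0r_1\cos_\pi(|x_0-x_1|)$, $\cos_\pi(L)=\cos(\min\{L,\pi\})$. $\mathcal M_2(\mathfrak C_\Omega)$ is the set of finite nonnegative Borel measures with $\int r^2\mathrm d\lambda<\infty$. $\mathsf W_{\mathfrak C}(\lambda_0,\lambda_1)^2=\inf\iint\mathsf d_{\mathfrak C}^2\,\mathrm d\gamma$ over nonnegative measures $\gamma$ on $\mathfrak C_\Omega\times\mathfrak C_\Omega$ with marginals $\lambda_0,\lambda_1$ ($=\infty$ if the masses differ). The projection $\mathfrak P:\mathcal M_2(\mathfrak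 C_\Omega)\to\mathcal M(\Omega)$ is given by $\int_\Omega\phi\,\mathrm d\mathfrak P\lambda=\int r^2\phi(x)\,\mathrm d\lambda([x,r])$, $\phi\in\mathrm C^0(\Omega)$. The Hellinger–Kantorovich distance is $\mathsf{HK}(\mu_0,\mu_1)=\min\{\mathsf W_{\mathfrak C}(\lambda_0,\lambda_1)\mid\mathfrak P\lambda_j=\mu_j\}$. A geodesic curve is a curve with $\mathsf{HK}(\mu(s),\mu(t))=|s-t|\,\mathsf{HK}(\mu(0),\mu(1))$ for all $s,t\in[0,1]$. *)

(* Defs.v *)
From HB Require Import structures.
From mathcomp Require Import all_boot all_order all_algebra.
From mathcomp Require Import all_classical all_reals all_analysis.

Set Implicit Arguments.
Unset Strict Implicit.
Unset Printing Implicit Defensive.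

Import Order.TTheory GRing.Theory Num.Theory.
Import numFieldNormedType.Exports.

Local Open Scope classical_set_scope.
Local Open Scope ring_scope.

(* The library norm on 'rV[R]_d is the sup norm; the topology it induces is the
   Euclidean one, so [open], [compact], [continuous] can be used as they are,
   but the distance between points has to be the following one. *)
Definition euclid_dist {R : realType} {d : nat} (x y : 'rV[R]_d) : R :=
  Num.sqrt (\sum_(i < d) (x 0 i - y 0 i) ^+ 2).

Definition cos_pi {R : realType} (L : R) : R := cos (Num.min L pi).

(* The set Omega as a type, with the subspace topology and its Borel
   sigma-algebra. Measurable types are required to be inhabited: the argument
   [x0] only serves as a witness for this. *)
Definition body {R : realType} {d : nat} {Omega : set 'rV[R]_d}
  (x0 : Omega) : Type := set_type Omega.

HB.instance Definition _ {R : realType} {d : nat} {Omega : set 'rV[R]_d}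
  (x0 : Omega) := Topological.copy (body x0) (set_type Omega).
HB.instance Definition _ {R : realType} {d : nat} {Omega : set 'rV[R]_d}
  (x0 : Omega) := isPointed.Build (body x0) x0.
HB.instance Definition _ {R : realType} {d : nat} {Omega : set 'rV[R]_d}
  (x0 : Omega) :=
  Measurable.copy (body x0) (g_sigma_algebraType (@open (body x0))).

Section cone.
Context {R : realType} {d : nat} {Omega : set 'rV[R]_d} (x0 : Omega).
Local Open Scope quotient_scope.

Definition cone_rel (p q : body x0 * {nonneg R}) : bool :=
  (p == q) || ((p.2%:num == 0) && (q.2%:num == 0)).

Lemma cone_rel_refl : reflexive cone_rel.
Proof. by move=> p; rewrite /cone_rel eqxx. Qed.

Lemma cone_rel_sym : symmetric cone_rel.
Proof. by move=> p q; rewrite /cone_rel eq_sym andbC. Qed.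

Lemma cone_rel_trans : transitive cone_rel.
Proof.
move=> q p r /orP[/eqP->//|/andP[p0 q0]] /orP[/eqP<-|/andP[_ r0]].
- by rewrite /cone_rel p0 q0 orbT.
- by rewrite /cone_rel p0 r0 orbT.
Qed.

Definition cone_equiv : equiv_rel (body x0 * {nonneg R})%type :=
  EquivRel cone_rel cone_rel_refl cone_rel_sym cone_rel_trans.

Definition cone : Type := {eq_quot cone_equiv}.

HB.instance Definition _ := Quotient.copy cone {eq_quot cone_equiv}.
HB.instance Definition _ := Choice.copy cone {eq_quot cone_equiv}.

Definition cone_pt (x : body x0) (r : {nonneg R}) : cone := \pi_cone (x, r).

HB.instance Definition _ := isPointed.Build cone (cone_pt x0 0%:nng).

(* Coordinates x and r of a point [x, r]. At the vertex [coneX] is an arbitrary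
   point of Omega; it is only used below multiplied by a power of [coneR]. *)
Definition coneX (p : cone) : body x0 := (repr p).1.
Definition coneR (p : cone) : R := (repr p).2%:num.

Definition cone_dist (p q : cone) : R :=
  Num.sqrt (coneR p ^+ 2 + coneR q ^+ 2
    - 2 * coneR p * coneR q * cos_pi (euclid_dist (val (coneX p)) (val (coneX q)))).

Definition cone_open : set (set cone) :=
  [set U | forall p, U p ->
    exists2 e : R, 0 < e & forall q, cone_dist p q < e -> U q].

HB.instance Definition _ :=
  Measurable.copy cone (g_sigma_algebraType cone_open).

End cone.

Section hellinger_kantorovich.
Context {R : realType} {d : nat} {Omega : set 'rV[R]_d} {x0 : Omega}.
Local Notation X := (body x0).
Local Notation C := (cone x0).
Local Open Scope ereal_scope.

Definition M2 : set {finite_measure set C -> \bar R} :=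
  [set lam | \int[lam]_p (coneR p ^+ 2)%:E < +oo].

(* The cone is a separable metric space, so the product sigma-algebra on C * C
   is the Borel sigma-algebra of the product. *)
Definition coupling (lam0 lam1 : {finite_measure set C -> \bar R}) :
    set {measure set (C * C)%type -> \bar R} :=
  [set gam | forall A : set C, measurable A ->
    pushforward gam fst A = lam0 A /\ pushforward gam snd A = lam1 A].

(* [ereal_inf set0 = +oo], the value when the masses differ. *)
Definition W_cone (lam0 lam1 : {finite_measure set C -> \bar R}) : \bar R :=
  sqrte (ereal_inf [set \int[gam]_pq (cone_dist pq.1 pq.2 ^+ 2)%:E
                   | gam in coupling lam0 lam1]).

Definition is_projection (lam : {finite_measure set C -> \bar R})
    (mu : {finite_measure set X -> \bar R}) : Prop :=
  forall phi : X -> R, continuous phi ->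
    \int[mu]_x (phi x)%:E = \int[lam]_p (coneR p ^+ 2 * phi (coneX p))%:E.

Definition lifts (mu : {finite_measure set X -> \bar R}) :
    set {finite_measure set C -> \bar R} :=
  [set lam | M2 lam /\ is_projection lam mu].

Definition HK (mu0 mu1 : {finite_measure set X -> \bar R}) : \bar R :=
  ereal_inf [set W_cone lam0 lam1 | lam0 in lifts mu0 & lam1 in lifts mu1].

Definition geodesic (c : {i01 R} -> {finite_measure set X -> \bar R}) : Prop :=
  forall s t : {i01 R},
    HK (c s) (c t) = `|s%:num - t%:num|%:E * HK (c 0%:i01%R) (c 1%:i01%R).

End hellinger_kantorovich.

(* The vector space of finite signed measures. Set functions of the library are
   defined on all subsets; to have equality of elements mean equality on
   measurable sets, the value on non-measurable sets is required to be 0. *)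
Section signed_measures.
Context {disp : measure_display} {T : measurableType disp} {R : realType}.

Definition signed_measure_pred : {pred set T -> R^o} :=
  [pred f | `[< (forall A, ~ measurable A -> f A = 0) /\
                semi_sigma_additive (fun A => (f A)%:E) >]].

Lemma signed_measure_closed : submod_closed signed_measure_pred.
Proof.
split=> [|a f g /asboolP[f0 fs] /asboolP[g0 gs]]; apply/asboolP; split.
- by [].
- move=> F mF tF mUF; rewrite (_ : (fun n => _) = cst 0%E); first exact: cvg_cst.
  by apply/funext => n; rewrite sumEFin big1.
- by move=> A nA; rewrite !fctE f0// g0// addr0 scaler0.
- move=> F mF tF mUF.
  have hf := fs F mF tF mUF; have hg := gs F mF tF mUF.
  have afin : a%:E \is a fin_num by [].
  have fg_def : ((a * f (\bigcup_n F n))%:E +? (g (\bigcup_n F n))%:E)%E by [].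
  have h := cvgeD fg_def (cvgeZl afin hf) hg.
  rewrite (_ : (fun n => _) = (fun n => a%:E * \sum_(0 <= i < n) (f (F i))%:E +
    \sum_(0 <= i < n) (g (F i))%:E)%E); first exact: h.
  apply/funext => n; rewrite !sumEFin -EFinM -EFinD; congr EFin.
  by rewrite mulr_sumr -big_split.
Qed.

HB.instance Definition _ :=
  GRing.isSubmodClosed.Build R (set T -> R^o) signed_measure_pred
    signed_measure_closed.

Record signed_measure := SignedMeasure {
  signed_measure_fun :> set T -> R^o ;
  _ : signed_measure_fun \in signed_measure_pred }.

HB.instance Definition _ := [isSub for signed_measure_fun].
HB.instance Definition _ := [Choice of signed_measure by <:].
HB.instance Definition _ := [SubChoice_isSubLmodule of signed_measure by <:].

Definition signed_fun (mu : {finite_measure set T -> \bar R}) (A : set T) : R^o :=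
  if `[< measurable A >] then fine (mu A) else 0.

Lemma signed_fun_pred mu : signed_fun mu \in signed_measure_pred.
Proof.
apply/asboolP; split=> [A nA|F mF tF mUF].
  by rewrite /signed_fun asboolF.
have E A : measurable A -> (signed_fun mu A)%:E = mu A.
  by move=> mA; rewrite /signed_fun asboolT// fineK// fin_num_measure.
rewrite E//; under eq_fun do under eq_bigr do rewrite E//.
exact: measure_semi_sigma_additive.
Qed.

Definition signed (mu : {finite_measure set T -> \bar R}) : signed_measure :=
  SignedMeasure (signed_fun_pred mu).

End signed_measures.
Arguments signed_measure {disp} T R.

Section linear_algebra.
Context {R : realType} {V : lmodType R}.

Definition lin_indep (S : set V) : Prop :=
  forall (n : nat) (v : 'I_n -> V) (a : 'I_n -> R),
    injective v -> (forall i, S (v i)) ->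
    \sum_(i < n) a i *: v i = 0 -> forall i, a i = 0.

Definition lin_span (S : set V) : set V :=
  [set w | exists (n : nat) (v : 'I_n -> V) (a : 'I_n -> R),
    (forall i, S (v i)) /\ w = \sum_(i < n) a i *: v i].

Definition finite_dim (W : set V) : Prop :=
  exists (n : nat) (v : 'I_n -> V), W = lin_span (range v).

End linear_algebra.

Section curves.
Context {R : realType} {d : nat} {Omega : set 'rV[R]_d} {x0 : Omega}.

(* The vector space of maps from [0,1] to finite signed measures on Omega, with
   pointwise operations. *)
Definition curve : lmodType R := ({i01 R} -> signed_measure (body x0) R)%type.

Definition geodesics_between
    (mu0 mu1 : {finite_measure set (body x0) -> \bar R}) : set curve :=
  [set ((fun t => signed (c t)) : curve) | c in
    [set c : {i01 R} -> {finite_measure set (body x0) -> \bar R} |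
      [/\ geodesic c, signed (c 0%:i01%R) = signed mu0
        & signed (c 1%:i01%R) = signed mu1]]].

End curves.

Section point_mass.
Context {R : realType} {d : nat} {Omega : set 'rV[R]_d} {x0 : Omega}.

Definition point_mass (a : {posnum R}) (y : body x0) :
    {finite_measure set (body x0) -> \bar R} := mscale a%:num%:nng (\d_y).

End point_mass.

(* Main.v *)
(** Write [c_i x] for the cosine of [min (|x - y_i|, pi / 2)], and [C_i nu] for the
    integral of [c_i ^ 2] against [nu]. Weak Kantorovich duality on the cone bounds
    [HK] from below; from a point mass it gives
      [HK (a delta_y, nu) ^ 2 >= a + nu(Omega) - 2 sqrt (a C_y nu)].
    If [nu] is the value at time [t] of a geodesic, both endpoint inequalities are
    tight, so with [p = (1 - t) sqrt a0], [q = t sqrt a1], [c = tcos |y0 - y1|],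
    [u = p + q c], [v = q + p c] one gets [C_0 nu = u ^ 2], [C_1 nu = v ^ 2], and [nu]
    is concentrated on the zeros of the nonnegative function
    [u v - p v c_0 ^ 2 - q u c_1 ^ 2]. For [|y0 - y1| < pi / 2] it has one zero, for
    [|y0 - y1| > pi / 2] only [y0] and [y1] are zeros, so [nu] is determined.
    For [|y0 - y1| = pi / 2] the zeros fill a whole segment, but the three conditions
    are affine in [nu] and by duality again imply
    [HK (nu_s, nu_t) >= |s - t| sqrt (a0 + a1)]; since [HK ^ 2] is jointly convex,
    geodesics form a convex set. Splitting the mass at [y0] into a part that vanishes
    through the vertex and a part that travels along the cone geodesic to [y1] gives
    a family whose atoms at time [1 / 2] are at distinct points. *)
From HB Require Import structures.
Require Import Defs.
From mathcomp Require Import all_boot all_order all_algebra.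
From mathcomp Require Import all_classical all_reals all_analysis measurable_realfun.
From mathcomp Require Import ring lra.

Set Implicit Arguments.
Unset Strict Implicit.
Unset Printing Implicit Defensive.

Import Order.TTheory GRing.Theory Num.Theory.
Import numFieldNormedType.Exports.

Local Open Scope classical_set_scope.
Local Open Scope ring_scope.

(** * Euclidean distance and trigonometry *)

(** The natural dual potential for a point mass is infinite off its atom. To stay with bounded
    continuous potentials, the pointwise dual inequality is only required on the zero sets of two
    penalty functions whose integrals against the measures vanish. Potentials and penalties can then
    all be taken in the span of 1, [c_0 ^ 2], [c_1 ^ 2], so every lower bound becomes a relation
    between the masses and the numbers [C_0], [C_1]. Weighting the two potentials by A and 1/A and
    taking the infimum over A produces the square roots. The cone metric truncates angles at pi, but
    the truncation that matters here is at pi/2: beyond it, sending mass through the vertex is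
    cheaper than moving it. Upper bounds come from explicit plans. They are recorded as plans of
    cost at most [K + e] for all e > 0, a form that survives sums and scaling and never asks for an
    optimal plan. *)

Section euclid.
Context {R : realType} {d : nat}.
Implicit Types x y z : 'rV[R]_d.

Lemma euclid_dist_ge0 x y : 0 <= euclid_dist x y.
Proof. exact: sqrtr_ge0. Qed.

Lemma euclid_dist_sqr x y :
  euclid_dist x y ^+ 2 = \sum_(i < d) (x 0 i - y 0 i) ^+ 2.
Proof. by rewrite sqr_sqrtr// sumr_ge0// => i _; exact: sqr_ge0. Qed.

Lemma euclid_distC x y : euclid_dist x y = euclid_dist y x.
Proof. by congr Num.sqrt; apply: eq_bigr => i _; rewrite -sqrrN opprB. Qed.

Lemma euclid_distxx x : euclid_dist x x = 0.
Proof. by rewrite /euclid_dist big1 ?sqrtr0// => i _; rewrite subrr expr0n. Qed.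

Lemma euclid_dist0_eq x y : euclid_dist x y = 0 -> x = y.
Proof.
move=> h; apply/rowP => i; apply/eqP; rewrite -subr_eq0 -sqrf_eq0.
have := euclid_dist_sqr x y; rewrite h expr0n/= => /esym/eqP.
rewrite psumr_eq0 => [/allP/(_ i (mem_index_enum i))//|j _]; exact: sqr_ge0.
Qed.

Lemma CauchySchwarz_sum (I : finType) (a b : I -> R) :
  (\sum_i a i * b i) ^+ 2 <= (\sum_i a i ^+ 2) * (\sum_i b i ^+ 2).
Proof.
set S := \sum_i a i * b i; set A := \sum_i a i ^+ 2; set B := \sum_i b i ^+ 2.
have B0 : 0 <= B by apply: sumr_ge0 => i _; exact: sqr_ge0.
have h : 0 <= \sum_i (B * a i - S * b i) ^+ 2 by apply: sumr_ge0 => i _; exact: sqr_ge0.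
have {h} : 0 <= B * (A * B - S ^+ 2).
  suff -> : B * (A * B - S ^+ 2) = \sum_i (B * a i - S * b i) ^+ 2 by [].
  rewrite [RHS](eq_bigr (fun i => B ^+ 2 * a i ^+ 2 - 2 * B * S * (a i * b i)
     + S ^+ 2 * b i ^+ 2)); last by move=> i _; ring.
  by rewrite big_split/= sumrB -!mulr_sumr -/A -/B -/S; ring.
have [B0'|B0'] := ltP 0 B; first by rewrite pmulr_rge0// subr_ge0.
have {B0'} B00 : B = 0 by apply/le_anti; rewrite B0 B0'.
suff -> : S = 0 by rewrite B00 mulr0 expr0n.
rewrite /S big1// => i _.
have /eqP := B00; rewrite psumr_eq0 => [/allP/(_ i (mem_index_enum i))/=|j _]; last exact: sqr_ge0.
by rewrite sqrf_eq0 => /eqP ->; rewrite mulr0.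
Qed.

Lemma euclid_dist_triangle x y z :
  euclid_dist x z <= euclid_dist x y + euclid_dist y z.
Proof.
rewrite -(@ler_pXn2r _ 2) ?nnegrE ?addr_ge0 ?euclid_dist_ge0//.
rewrite sqrrD !euclid_dist_sqr.
set a := fun i : 'I_d => x 0 i - y 0 i; set b := fun i : 'I_d => y 0 i - z 0 i.
have -> : \sum_(i < d) (x 0 i - z 0 i) ^+ 2 =
    \sum_i a i ^+ 2 + (\sum_i a i * b i) *+ 2 + \sum_i b i ^+ 2.
  by rewrite -sumrMnl -!big_split/=; apply: eq_bigr => i _; rewrite /a/b; ring.
rewrite lerD2r lerD2l lerMn2r/=; apply: (le_trans (ler_norm _)).
rewrite -sqrtr_sqr /euclid_dist -sqrtrM; last by apply: sumr_ge0 => i _; exact: sqr_ge0.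
by apply: ler_wsqrtr; exact: CauchySchwarz_sum.
Qed.

Lemma euclid_dist_line x y (k l : R) :
  euclid_dist (x + k *: (y - x)) (x + l *: (y - x)) = `|k - l| * euclid_dist x y.
Proof.
rewrite /euclid_dist -[`|_|]sqrtr_sqr -sqrtrM ?sqr_ge0//; congr Num.sqrt.
by rewrite mulr_sumr; apply: eq_bigr => i _; rewrite !mxE; ring.
Qed.

(** Equality case of the triangle inequality. With k = |x - z| / |x - y|, Stewart's identity gives
    the squared distance from z to the candidate point as (1 - k) |x - z|^2 + k |z - y|^2 - k (1 -
    k) |x - y|^2, which is 0. *)
Lemma euclid_dist_between x y z : 0 < euclid_dist x y ->
  euclid_dist x y = euclid_dist x z + euclid_dist z y ->
  z = x + (euclid_dist x z / euclid_dist x y) *: (y - x).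
Proof.
set L := euclid_dist x y; set a := euclid_dist x z => L0 h.
set k := a / L; apply: euclid_dist0_eq; apply/eqP; rewrite -sqrf_eq0 euclid_dist_sqr.
have ka : k * L = a by rewrite /k divfK// gt_eqF.
have hb : euclid_dist z y ^+ 2 = (L - a) ^+ 2 by rewrite h addrC addKr.
have ha : a ^+ 2 = \sum_i (x 0 i - z 0 i) ^+ 2 by rewrite euclid_dist_sqr.
have hL : L ^+ 2 = \sum_i (x 0 i - y 0 i) ^+ 2 by rewrite euclid_dist_sqr.
rewrite (eq_bigr (fun i => (1 - k) * (x 0 i - z 0 i) ^+ 2
   - k * (1 - k) * (x 0 i - y 0 i) ^+ 2
   + k * (z 0 i - y 0 i) ^+ 2)); last by move=> i _; rewrite !mxE; ring.
rewrite big_split/= sumrB -!mulr_sumr -ha -hL -euclid_dist_sqr hb -ka.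
by apply/eqP; ring.
Qed.

End euclid.

Section trig.
Context {R : realType}.
Implicit Types (L x y c p q : R).

Definition tcos x : R := cos (Num.min x (pi / 2)).
Definition tsin x : R := sin (Num.min x (pi / 2)).

Lemma ler_cos x y : 0 <= x -> x <= y -> y <= pi -> cos y <= cos x.
Proof.
move=> x0 xy yp; rewrite leNgt ltr_cos ?in_itv/= ?x0 ?yp ?(le_trans x0)// ?(le_trans xy)//.
by rewrite -leNgt.
Qed.

Lemma tcos2D_tsin2 x : tcos x ^+ 2 + tsin x ^+ 2 = 1.
Proof. exact: cos2Dsin2. Qed.

Lemma min_pihalf x : 0 <= x -> 0 <= Num.min x (pi / 2) <= pi / 2.
Proof. by move=> x0; rewrite le_min x0 divr_ge0 ?pi_ge0//= ge_min lexx orbT. Qed.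

Lemma tcos_ge0 x : 0 <= x -> 0 <= tcos x.
Proof.
move=> /min_pihalf/andP[h1 h2]; apply: cos_ge0_pihalf.
by rewrite h2 andbT; lra.
Qed.

Lemma tcos_le1 x : tcos x <= 1. Proof. exact: cos_le1. Qed.

Lemma tsin_ge0 x : 0 <= x -> 0 <= tsin x.
Proof. move=> /min_pihalf/andP[h1 h2]; apply: sin_ge0_pi; lra. Qed.

Lemma tcos0 : tcos 0 = 1.
Proof. by rewrite /tcos min_l ?cos0// divr_ge0// pi_ge0. Qed.

Lemma tcosE x : x <= pi / 2 -> tcos x = cos x.
Proof. by move=> h; rewrite /tcos min_l. Qed.

Lemma tcos_eq0 x : pi / 2 <= x -> tcos x = 0.
Proof. by move=> h; rewrite /tcos min_r// cos_pihalf. Qed.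

Lemma tcos_gt0 x : 0 <= x < pi / 2 -> 0 < tcos x.
Proof. by move=> /andP[h1 h2]; rewrite tcosE ?ltW//; apply: cos_gt0_pihalf; lra. Qed.

Lemma cos_pi_le1 x : cos_pi x <= 1. Proof. exact: cos_le1. Qed.

Lemma cos_piE x : x <= pi / 2 -> cos_pi x = cos x.
Proof. by move=> h; rewrite /cos_pi min_l//; have := pi_gt0 R; lra. Qed.

Lemma cos_pi_le_tcos x : 0 <= x -> cos_pi x <= tcos x.
Proof.
move=> x0; rewrite /cos_pi /tcos; apply: ler_cos.
- by have /andP[] := min_pihalf x0.
- have := pi_gt0 R; rewrite le_min !ge_min lexx/= => ?; apply/orP; right; lra.
- by rewrite ge_min lexx orbT.
Qed.

(** Truncation at pi/2 is subadditive, and the sum of two truncated angles stays in [0, pi], where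
    the cosine decreases. *)
Lemma tcosD_le x y L : 0 <= x -> 0 <= y -> 0 <= L -> L <= x + y ->
  tcos x * tcos y - tsin x * tsin y <= tcos L.
Proof.
move=> x0 y0 L0 h; rewrite -cosD; apply: ler_cos.
- by have /andP[] := min_pihalf L0.
- have /andP[? ?] := min_pihalf x0; have /andP[? ?] := min_pihalf y0.
  by rewrite /Num.min; case: ifP => h1; case: ifP => h2; case: ifP => h3;
    move: h1 h2 h3 => /negP + /negP + /negP; lra.
- have /andP[_ ?] := min_pihalf x0; have /andP[_ ?] := min_pihalf y0; lra.
Qed.

(** Truncation at pi/2 is 1-Lipschitz, so the difference of the truncated angles is at most [L], and
    it is also below pi. *)
Lemma cos_pi_le_tcosB x y L : 0 <= x -> 0 <= y -> `|x - y| <= L ->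
  cos_pi L <= tcos x * tcos y + tsin x * tsin y.
Proof.
move=> x0 y0 h; rewrite -cosB -cos_norm /cos_pi; apply: ler_cos => //; last first.
  by rewrite ge_min lexx orbT.
rewrite le_min; apply/andP; split; last first.
  have /andP[? ?] := min_pihalf x0; have /andP[? ?] := min_pihalf y0.
  by rewrite ler_norml; apply/andP; split; lra.
apply: le_trans h; rewrite ler_norml; move: (ler_norm (x - y)) (ler_norm (y - x)).
rewrite (distrC y) => h1 h2.
by rewrite /Num.min; case: ifP => h3; case: ifP => h4; apply/andP; split; lra.
Qed.

(* The function of the header with [c_0], [c_1] as variables; for unit vectors [e_0],
   [e_1] at angle [L], it vanishes in the direction of [p e_0 + q e_1]. *)
Definition angle_gap p q c c0 c1 : R :=
  (p + q * c) * (q + p * c) - p * (q + p * c) * c0 ^+ 2 - q * (p + q * c) * c1 ^+ 2.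

(** With [s0], [s1] the sines, the first summand is nonnegative by the triangle inequality for
    angles and the second is [c] times a square. If [c], [p], [q] are positive, vanishing forces the
    angles to add up and p sin x = q sin y, the sine rule for the direction of [p e_0 + q e_1]. *)
Lemma angle_gapE p q c c0 c1 s0 s1 :
  c0 ^+ 2 + s0 ^+ 2 = 1 -> c1 ^+ 2 + s1 ^+ 2 = 1 ->
  angle_gap p q c c0 c1 =
  p * q * ((c + s0 * s1) ^+ 2 - c0 ^+ 2 * c1 ^+ 2) + c * (p * s0 - q * s1) ^+ 2.
Proof.
move=> h0 h1; rewrite /angle_gap.
have -> : c0 ^+ 2 = 1 - s0 ^+ 2 by lra.
have -> : c1 ^+ 2 = 1 - s1 ^+ 2 by lra.
ring.
Qed.

Lemma angle_gap_ge0 x y L p q : 0 <= x -> 0 <= y -> 0 <= L -> L <= x + y ->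
  0 <= p -> 0 <= q -> 0 <= angle_gap p q (tcos L) (tcos x) (tcos y).
Proof.
move=> x0 y0 L0 h p0 q0.
rewrite (angle_gapE _ _ _ (tcos2D_tsin2 x) (tcos2D_tsin2 y)).
have := tcosD_le x0 y0 L0 h.
have cx := tcos_ge0 x0; have cy := tcos_ge0 y0; have cL := tcos_ge0 L0.
have sx := tsin_ge0 x0; have sy := tsin_ge0 y0 => h1.
apply: addr_ge0; last by rewrite mulr_ge0 ?sqr_ge0.
have ? : 0 <= tcos x * tcos y by rewrite mulr_ge0.
have ? : 0 <= tsin x * tsin y by rewrite mulr_ge0.
rewrite mulr_ge0 ?mulr_ge0// -exprMn subr_ge0.
rewrite ler_pXn2r ?nnegrE ?addr_ge0 ?mulr_ge0//; lra.
Qed.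

Lemma angle_gap_eq0 x y L p q : 0 <= x -> 0 <= y -> 0 <= L < pi / 2 -> L <= x + y ->
  0 < p -> 0 < q -> angle_gap p q (tcos L) (tcos x) (tcos y) = 0 ->
  L = x + y /\ p * sin x = q * sin y.
Proof.
move=> x0 y0 /andP[L0 L2] h p0 q0.
have cL : 0 < tcos L by apply: tcos_gt0; rewrite L0.
rewrite (angle_gapE _ _ _ (tcos2D_tsin2 x) (tcos2D_tsin2 y)).
have := tcosD_le x0 y0 L0 h.
have cx := tcos_ge0 x0; have cy := tcos_ge0 y0.
have sx := tsin_ge0 x0; have sy := tsin_ge0 y0 => h1 /eqP.
have cc0 : 0 <= tcos x * tcos y by rewrite mulr_ge0.
have ss0 : 0 <= tsin x * tsin y by rewrite mulr_ge0.
rewrite paddr_eq0; last 2 first.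
- rewrite mulr_ge0 ?mulr_ge0 ?(ltW p0) ?(ltW q0)// -exprMn subr_ge0.
  by rewrite ler_pXn2r ?nnegrE ?addr_ge0 ?mulr_ge0 ?(ltW cL)//; lra.
- by rewrite mulr_ge0 ?sqr_ge0// ltW.
rewrite !mulf_eq0 !(gt_eqF cL, gt_eqF p0, gt_eqF q0)/= orbb !subr_eq0 => /andP[/eqP h2 /eqP h3].
have {h2} h2 : tcos L + tsin x * tsin y = tcos x * tcos y.
  by apply: (@pexpIrn R 2) => //; rewrite ?nnegrE ?addr_ge0 ?(ltW cL)// exprMn.
have mxy : L = Num.min x (pi / 2) + Num.min y (pi / 2).
  have /andP[? ?] := min_pihalf x0; have /andP[? ?] := min_pihalf y0.
  apply: (@cos_inj R); rewrite ?in_itv/=.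
  - by apply/andP; split; lra.
  - by apply/andP; split; lra.
  rewrite cosD -tcosE ?(ltW L2)// -/(tcos x) -/(tcos y) -/(tsin x) -/(tsin y); lra.
have /andP[? ?] := min_pihalf x0; have /andP[? ?] := min_pihalf y0.
have hx : x < pi / 2.
  by rewrite ltNge; apply/negP => hx; move: mxy; rewrite (min_r hx); lra.
have hy : y < pi / 2.
  by rewrite ltNge; apply/negP => hy; move: mxy; rewrite (min_r hy); lra.
by move: mxy h3; rewrite /tsin !min_l ?ltW.
Qed.

(** Here [tcos L] is 0, and vanishing says that the truncated angles add up to pi/2. If neither were
    truncated, x + y would be pi/2 < L; so one of them is pi/2 and the other is 0. *)
Lemma angle_gap_eq0_ge x y L p q : 0 <= x -> 0 <= y -> pi / 2 < L -> L <= x + y ->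
  0 < p -> 0 < q -> angle_gap p q (tcos L) (tcos x) (tcos y) = 0 -> x = 0 \/ y = 0.
Proof.
move=> x0 y0 L2 h p0 q0; rewrite (tcos_eq0 (ltW L2)).
rewrite (angle_gapE _ _ _ (tcos2D_tsin2 x) (tcos2D_tsin2 y)) mul0r addr0 add0r => /eqP.
rewrite mulf_eq0 mulf_eq0 (gt_eqF p0) (gt_eqF q0)/= subr_eq0 -exprMn => /eqP h1.
have : cos (Num.min x (pi / 2) + Num.min y (pi / 2)) = cos (pi / 2).
  rewrite cosD cos_pihalf; apply/eqP; rewrite subr_eq0; apply/eqP/esym.
  by apply: (@pexpIrn R 2); rewrite // nnegrE ?mulr_ge0 ?tcos_ge0 ?tsin_ge0.
have /andP[? ?] := min_pihalf x0; have /andP[? ?] := min_pihalf y0.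
move=> hcos; have : Num.min x (pi / 2) + Num.min y (pi / 2) = pi / 2.
  by apply: (@cos_inj R) => //; rewrite in_itv/=; apply/andP; split; lra.
have [hx|hx] := leP x (pi / 2); have [hy|hy] := leP y (pi / 2); try lra.
all: have := pi_gt0 R; rewrite ?(min_l hx) ?(min_l hy) ?(min_r (ltW hx)) ?(min_r (ltW hy)); lra.
Qed.

End trig.

(** * Polar coordinates of a segment in a planar sector *)

Section planar.
Context {R : realType}.
Variables (L b0 b1 : R).
Hypothesis L0 : 0 <= L <= pi / 2.
Hypothesis b0_gt0 : 0 < b0.
Hypothesis b1_gt0 : 0 < b1.

(** The segment joins the point at radius [b0], angle 0, to the point at radius [b1], angle [L]. The
    cone over an arc of length [L] is isometric to this sector, so the polar coordinates [planarR],
    [planarA] describe a cone geodesic. *)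
Definition planarX (t : R) : R := (1 - t) * b0 + t * b1 * cos L.
Definition planarY (t : R) : R := t * b1 * sin L.
Definition planarR (t : R) : R := Num.sqrt (planarX t ^+ 2 + planarY t ^+ 2).
Definition planarA (t : R) : R := acos (planarX t / planarR t).

Let cosL0 : 0 <= cos L.
Proof. move: L0 => /andP[? ?]; apply: cos_ge0_pihalf; lra. Qed.

Let sinL0 : 0 <= sin L.
Proof. move: L0 => /andP[? ?]; have := pi_gt0 R; move=> ?; apply: sin_ge0_pi; lra. Qed.

Lemma planarX_ge0 t : 0 <= t <= 1 -> 0 <= planarX t.
Proof.
move=> /andP[t0 t1]; rewrite addr_ge0 ?mulr_ge0// ?subr_ge0// ltW//.
Qed.

Lemma planarY_ge0 t : 0 <= t <= 1 -> 0 <= planarY t.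
Proof. by move=> /andP[t0 t1]; rewrite !mulr_ge0// ltW. Qed.

Lemma planarR2 t : planarR t ^+ 2 = planarX t ^+ 2 + planarY t ^+ 2.
Proof. by rewrite sqr_sqrtr// addr_ge0 ?sqr_ge0. Qed.

Lemma planarR2E t : planarR t ^+ 2 =
  ((1 - t) * b0) ^+ 2 + (t * b1) ^+ 2 + 2 * ((1 - t) * b0) * (t * b1) * cos L.
Proof.
rewrite planarR2 /planarX /planarY.
have -> : (t * b1 * sin L) ^+ 2 = (t * b1) ^+ 2 * (1 - cos L ^+ 2).
  by rewrite -sin2cos2 exprMn.
ring.
Qed.

Lemma planarR_ge0 t : 0 <= planarR t. Proof. exact: sqrtr_ge0. Qed.

Lemma planarR_gt0 t : 0 <= t <= 1 -> 0 < planarR t.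
Proof.
move=> /andP[t0 t1]; rewrite lt_neqAle planarR_ge0 andbT eq_sym -sqrf_eq0 planarR2E.
apply: lt0r_neq0.
have h1 : 0 <= 2 * ((1 - t) * b0) * (t * b1) * cos L.
  by rewrite !mulr_ge0// ?subr_ge0// ltW.
have [->|t_neq0] := eqVneq t 0.
  have := exprn_gt0 2 b0_gt0; rewrite subr0 !mul1r !(mul0r, mulr0) expr0n/= addr0; lra.
have h2 : 0 < (t * b1) ^+ 2.
  by rewrite exprn_gt0// mulr_gt0// lt_neqAle eq_sym t_neq0.
have := sqr_ge0 ((1 - t) * b0); lra.
Qed.

Section point.
Variable t : R.
Hypothesis t01 : 0 <= t <= 1.
Let Rt := planarR_gt0 t01.

Lemma planar_ratio : 0 <= planarX t / planarR t <= 1.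
Proof.
rewrite divr_ge0 ?planarX_ge0 ?planarR_ge0//= ler_pdivrMr// mul1r.
rewrite -(@ler_pXn2r _ 2) ?nnegrE ?planarX_ge0 ?planarR_ge0// planarR2.
by rewrite lerDl sqr_ge0.
Qed.

Lemma planarX_cos : planarR t * cos (planarA t) = planarX t.
Proof.
have /andP[h0 h1] := planar_ratio.
rewrite acosK; first by rewrite mulrC divfK// gt_eqF.
by rewrite in_itv/= h1 andbT; lra.
Qed.

Lemma planarY_sin : planarR t * sin (planarA t) = planarY t.
Proof.
have /andP[h0 h1] := planar_ratio.
rewrite sin_acos; last by rewrite h1 andbT; lra.
rewrite -[X in X * _](ger0_norm (planarR_ge0 t)) -sqrtr_sqr -sqrtrM ?sqr_ge0//.
rewrite mulrBr mulr1 -exprMn [_ * (_ / _)]mulrC divfK ?gt_eqF// planarR2 addrC addKr.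
by rewrite sqrtr_sqr ger0_norm// planarY_ge0.
Qed.

(** For the upper bound: an angle above [L] gives X < R cos L, which after squaring becomes X sin L
    < Y cos L. But X sin L - Y cos L = (1 - t) b0 sin L is nonnegative. *)
Lemma planarA_itv : 0 <= planarA t <= L.
Proof.
have /andP[h0 h1] := planar_ratio.
have A0 : 0 <= planarA t by apply: acos_ge0; rewrite h1 andbT; lra.
have Ap : planarA t <= pi by apply: acos_lepi; rewrite h1 andbT; lra.
rewrite A0/= leNgt; apply/negP => LA.
have Lpi : L <= pi by have := pi_gt0 R; lra.
have := ltr_cos; move=> /(_ R L (planarA t)).
rewrite !in_itv/= A0 Ap Lpi; move: L0 => /andP[-> _] /(_ isT isT)/esym.
rewrite LA => hc.
have hX : planarX t < planarR t * cos L by rewrite -planarX_cos ltr_pM2l.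
have hc0 : 0 <= planarR t * cos L by rewrite mulr_ge0 ?planarR_ge0.
have : planarX t ^+ 2 < (planarR t * cos L) ^+ 2.
  by rewrite ltr_pXn2r ?nnegrE ?planarX_ge0.
rewrite exprMn planarR2 => h.
have : planarX t * sin L < planarY t * cos L.
  rewrite -(@ltr_pXn2r _ 2) ?nnegrE ?(mulr_ge0 (planarX_ge0 t01))//; last first.
    exact: (mulr_ge0 (planarY_ge0 t01)).
  move: h; generalize (planarX t) (planarY t) => u v h.
  rewrite !exprMn sin2cos2 -subr_gt0; move: h; rewrite -subr_gt0 => h.
  suff -> : v ^+ 2 * cos L ^+ 2 - u ^+ 2 * (1 - cos L ^+ 2) =
     (u ^+ 2 + v ^+ 2) * cos L ^+ 2 - u ^+ 2 by [].
  by ring.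
rewrite /planarX /planarY => h'.
have : 0 <= (1 - t) * b0 * sin L.
  by move: t01 => /andP[? ?]; rewrite !mulr_ge0// ?subr_ge0// ltW.
lra.
Qed.

End point.

(** Law of cosines: both sides are the squared distance between the points of the segment at times
    [s] and [t]. *)
Lemma planar_dist s t : 0 <= s <= 1 -> 0 <= t <= 1 ->
  planarR s ^+ 2 + planarR t ^+ 2
    - 2 * planarR s * planarR t * cos (planarA s - planarA t) =
  (s - t) ^+ 2 * (b0 ^+ 2 + b1 ^+ 2 - 2 * b0 * b1 * cos L).
Proof.
move=> s01 t01; rewrite cosB.
have -> : 2 * planarR s * planarR t * (cos (planarA s) * cos (planarA t) +
   sin (planarA s) * sin (planarA t)) =
   2 * (planarX s * planarX t + planarY s * planarY t).
  by rewrite -!planarX_cos// -!planarY_sin//; ring.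
rewrite !planarR2 /planarX /planarY.
transitivity ((s - t) ^+ 2 * (b0 ^+ 2 + b1 ^+ 2 * (cos L ^+ 2 + sin L ^+ 2) - 2 * b0 * b1 * cos L)).
  by ring.
by rewrite cos2Dsin2; ring.
Qed.

Lemma planarR0 : planarR 0 = b0.
Proof.
by rewrite /planarR /planarX /planarY subr0 !mul0r mul1r expr0n/= !addr0 sqrtr_sqr ger0_norm// ltW.
Qed.

Lemma planarA0 : planarA 0 = 0.
Proof.
rewrite /planarA planarR0 /planarX subr0 !mul0r mul1r addr0 divff ?acos1//.
by rewrite gt_eqF.
Qed.

Lemma planarR1 : planarR 1 = b1.
Proof.
rewrite /planarR /planarX /planarY subrr !mul0r mul1r add0r !exprMn -mulrDr cos2Dsin2.
by rewrite mulr1 sqrtr_sqr ger0_norm// ltW.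
Qed.

Lemma planarA1 : planarA 1 = L.
Proof.
rewrite /planarA planarR1 /planarX subrr !mul0r mul1r add0r mulrAC divff ?gt_eqF//.
rewrite mul1r cosK// in_itv/=; move: L0 => /andP[-> ?]/=.
by have := pi_gt0 R; lra.
Qed.

End planar.

Section amgm.
Context {R : realType}.
Implicit Types (u v K A : R).

(** The minimizer A = v / u exists only for positive [u] and [v]. Shifting both by [d] covers the
    degenerate cases with an excess of d (u + v), and [d] is chosen to keep this below [e]. *)
Lemma ler_amgm_inf u v K : 0 <= u -> 0 <= v ->
  (forall A, 0 < A -> K <= A * u ^+ 2 + v ^+ 2 / A) -> K <= 2 * u * v.
Proof.
move=> u0 v0 h; apply/ler_addgt0Pr => e e0.
pose d := e / (u + v + 1).
have w0 : 0 < u + v + 1 by rewrite ltr_wpDl ?addr_ge0.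
have d0 : 0 < d by rewrite divr_gt0.
have ud : 0 < u + d by rewrite ltr_wpDl.
have vd : 0 < v + d by rewrite ltr_wpDl.
apply: (le_trans (h _ (divr_gt0 vd ud))).
rewrite invf_div.
have h1 : (v + d) / (u + d) * u ^+ 2 <= (v + d) * u.
  rewrite -mulrA ler_pM2l// mulrC ler_pdivrMr//.
  by rewrite expr2 ler_wpM2l// lerDl ltW.
have h2 : v ^+ 2 * ((u + d) / (v + d)) <= v * (u + d).
  rewrite mulrA ler_pdivrMr// expr2 -!mulrA ler_wpM2l// mulrC ler_wpM2l ?ltW//.
  by rewrite ltrDl.
have h3 : d * (u + v) <= e.
  have -> : e = d * (u + v + 1) by rewrite /d divfK// gt_eqF.
  by rewrite ler_pM2l// lerDl.
lra.
Qed.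

(** Positivity of a 2 by 2 quadratic form in [r], [s] from its determinant; the pointwise dual
    condition on the cone has this shape. *)
Lemma two_mul_le u v (r s c : R) : c ^+ 2 <= u * v -> 0 <= u -> 0 <= v ->
  0 <= r -> 0 <= s ->
  2 * r * s * c <= u * r ^+ 2 + v * s ^+ 2.
Proof.
move=> h u0 v0 r0 s0.
have h1 : r * s * c <= Num.sqrt (u * r ^+ 2) * Num.sqrt (v * s ^+ 2).
  rewrite -sqrtrM ?mulr_ge0 ?sqr_ge0// (le_trans (ler_norm _))// -sqrtr_sqr.
  apply: ler_wsqrtr; rewrite (_ : u * _ * _ = (r * s) ^+ 2 * (u * v)); last by ring.
  by rewrite exprMn ler_wpM2l ?sqr_ge0.
have := sqr_ge0 (Num.sqrt (u * r ^+ 2) - Num.sqrt (v * s ^+ 2)).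
rewrite sqrrB !sqr_sqrtr ?mulr_ge0 ?sqr_ge0//; lra.
Qed.

End amgm.

(** * Measurability on the cone *)

Lemma continuous_euclid_dist {R : realType} {d : nat} (y : 'rV[R]_d) :
  continuous (fun x : 'rV[R]_d => euclid_dist x y).
Proof.
move=> x; apply: (@continuous_comp 'rV[R]_d R R (fun z => \sum_(i < d) (z 0 i - y 0 i) ^+ 2)).
  apply: (@cvg_big _ _ _ _ xpredT add_continuous _ _ _ _ _ (nbhs_filter x)) => i _.
  apply: (@cvg_comp _ _ _ (fun z : 'rV[R]_d => z 0 i - y 0 i) (fun u : R => u ^+ 2) (nbhs x) (nbhs (x 0 i - y 0 i : R))).
    by apply: cvgB; [exact: coord_continuous|exact: cvg_cst].
  exact: exprn_continuous.
exact: sqrt_continuous.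
Qed.

Section cone_theory.
Context {R : realType} {d : nat} {Omega : set 'rV[R]_d} {x0 : Omega}.
Local Notation X := (body x0).
Local Notation C := (cone x0).
Implicit Types (p q : C) (x y : X) (r s : {nonneg R}).

Definition bdist x y : R := euclid_dist (val x) (val y).

Lemma bdist_ge0 x y : 0 <= bdist x y. Proof. exact: euclid_dist_ge0. Qed.

Lemma coneP p (x : X) r : p = cone_pt x r ->
  cone_rel (repr p) (x, r).
Proof.
move=> pE; apply/(@eqquotP _ _ (cone x0)); rewrite reprK; exact: pE.
Qed.

Lemma coneR_pt x r : coneR (cone_pt x r) = r%:num.
Proof.
have := coneP (erefl (cone_pt x r)); rewrite /cone_rel /coneR => /orP[/eqP->//|].
by case/andP => /eqP -> /eqP ->.
Qed.

Lemma coneX_pt x r : r%:num != 0 -> coneX (cone_pt x r) = x.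
Proof.
have := coneP (erefl (cone_pt x r)); rewrite /cone_rel /coneX => /orP[/eqP->//|].
by case/andP => _ ->.
Qed.

Lemma coneR_ge0 p : 0 <= coneR p. Proof. by rewrite /coneR. Qed.

Lemma coneR0_eq p q : coneR p = 0 -> coneR q = 0 -> p = q.
Proof.
move=> p0 q0; rewrite -[p]reprK -[q]reprK; apply/(@eqquotP _ _ (cone x0)).
by rewrite /cone_equiv/= /cone_rel; move: p0 q0; rewrite /coneR => -> ->; rewrite eqxx orbT.
Qed.

Lemma cone_dist_sqr p q : cone_dist p q ^+ 2 = coneR p ^+ 2 + coneR q ^+ 2
    - 2 * coneR p * coneR q * cos_pi (bdist (coneX p) (coneX q)).
Proof.
rewrite sqr_sqrtr// -/(bdist _ _); set c := cos_pi _.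
have c1 : c <= 1 by exact: cos_pi_le1.
have p0 := coneR_ge0 p; have q0 := coneR_ge0 q.
have h : 0 <= 2 * coneR p * coneR q * (1 - c) by rewrite !mulr_ge0// subr_ge0.
have := sqr_ge0 (coneR p - coneR q); lra.
Qed.

Lemma cone_dist_ge0 p q : 0 <= cone_dist p q. Proof. exact: sqrtr_ge0. Qed.

Lemma cone_dist_pt x r y s : cone_dist (cone_pt x r) (cone_pt y s) ^+ 2 =
  r%:num ^+ 2 + s%:num ^+ 2 - 2 * r%:num * s%:num * cos_pi (bdist x y).
Proof.
rewrite cone_dist_sqr !coneR_pt.
have [->|r0] := eqVneq r%:num 0; first by rewrite !(mulr0, mul0r).
have [->|s0] := eqVneq s%:num 0; first by rewrite !(mulr0, mul0r).
by rewrite !coneX_pt.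
Qed.

Lemma cone_dist_coneR p q : `|coneR p - coneR q| <= cone_dist p q.
Proof.
rewrite -(@ler_pXn2r _ 2) ?nnegrE ?cone_dist_ge0// real_normK ?num_real//.
rewrite cone_dist_sqr.
have c1 := cos_pi_le1 (bdist (coneX p) (coneX q)).
have h : 0 <= 2 * coneR p * coneR q * (1 - cos_pi (bdist (coneX p) (coneX q))).
  by rewrite !mulr_ge0 ?coneR_ge0// subr_ge0.
lra.
Qed.

(** The left side is the distance from [p] to a ray at angle [eta]. Away from the vertex, closeness
    in the cone therefore forces closeness of the base points. *)
Lemma cone_dist_angle p q (eta : R) : 0 < eta <= pi / 2 ->
  eta <= bdist (coneX p) (coneX q) -> coneR p * sin eta <= cone_dist p q.
Proof.
move=> /andP[e0 e1] h.
have pi0 := pi_gt0 R.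
have se : 0 <= sin eta by apply: sin_ge0_pi; lra.
rewrite -(@ler_pXn2r _ 2) ?nnegrE ?mulr_ge0 ?coneR_ge0 ?cone_dist_ge0//.
rewrite cone_dist_sqr exprMn sin2cos2.
have h1 : cos_pi (bdist (coneX p) (coneX q)) <= cos eta.
  rewrite /cos_pi; apply: ler_cos; [exact: ltW| |by rewrite ge_min lexx orbT].
  by rewrite le_min h/=; lra.
have h2 : 0 <= 2 * coneR p * coneR q * (cos eta - cos_pi (bdist (coneX p) (coneX q))).
  by rewrite !mulr_ge0 ?coneR_ge0// subr_ge0.
have := sqr_ge0 (coneR q - coneR p * cos eta); rewrite sqrrB exprMn; lra.
Qed.

Lemma cone_open_measurable (U : set C) : cone_open U -> measurable U.
Proof. exact: sub_sigma_algebra. Qed.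

Lemma measurable_coneR : measurable_fun [set: C] (@coneR R d Omega x0).
Proof.
apply: (measurability _ (RGenOInfty.measurableE R)) => _ [_ [a ->] <-].
apply: cone_open_measurable => p [_]; rewrite /= in_itv/= andbT => ap.
exists (coneR p - a); first by rewrite subr_gt0.
move=> q /(le_lt_trans (cone_dist_coneR p q)) h; split => //=.
rewrite in_itv/= andbT; have := ler_norm (coneR p - coneR q); lra.
Qed.

Lemma cone_open_coneX (U : set X) : open U ->
  cone_open [set p : C | 0 < coneR p /\ U (coneX p)].
Proof.
move=> [V oV VU] p [p0 Up].
have Vp : V (val (coneX p)) by move: Up; rewrite -VU.
have /nbhs_ballP[e /= e0 eV] : nbhs (val (coneX p)) V by exact: open_nbhs_nbhs.
have pi0 := pi_gt0 R.
pose eta := Num.min e (pi / 2).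
have eta0 : 0 < eta by rewrite lt_min e0 divr_gt0.
have etah : eta <= pi / 2 by rewrite ge_min lexx orbT.
have se : 0 < sin eta by apply: sin_gt0_pi; rewrite eta0/=; lra.
exists (coneR p * sin eta); first by rewrite mulr_gt0.
move=> q hq; split.
  have h1 := le_lt_trans (cone_dist_coneR p q) hq.
  have h2 : coneR p * sin eta <= coneR p by rewrite ler_piMr ?sin_le1 ?ltW.
  have := ler_norm (coneR p - coneR q); lra.
rewrite -VU; apply: eV => /=; split => // i j.
have hd : bdist (coneX p) (coneX q) < eta.
  rewrite ltNge; apply/negP => hd; move: hq; rewrite ltNge => /negP; apply.
  by apply: cone_dist_angle => //; rewrite eta0.
(* Balls of the row space are taken in the sup norm, and each coordinate difference is bounded by
   the Euclidean distance. *)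
rewrite ord1 /ball/=; apply: le_lt_trans (lt_le_trans hd _); last by rewrite ge_min lexx.
rewrite -sqrtr_sqr; apply: ler_wsqrtr; rewrite (bigD1 j)//= lerDl.
by apply: sumr_ge0 => k _; exact: sqr_ge0.
Qed.

(** At the vertex [coneX] is an arbitrary choice and not continuous. Off the vertex the preimage of
    an open set is open, and the vertex is a single measurable point that belongs to the preimage or
    not. *)
Lemma measurable_coneX : measurable_fun [set: C] (@coneX R d Omega x0).
Proof.
apply: (@measurability _ _ C X setT (@coneX R d Omega x0) (@open X) erefl) => _ [U oU <-].
have m0 : measurable [set p : C | coneR p = 0].
  have := measurable_coneR; move=> /(_ measurableT _ (measurable_set1 0)).
  by rewrite setTI.
rewrite (_ : _ `&` _ = [set p : C | 0 < coneR p /\ U (coneX p)] `|`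
   ([set p : C | coneR p = 0] `&` [set p : C | coneR p = 0 /\ U (coneX p)])); last first.
  apply/seteqP; split => [p [_ /= Up]|p /=].
    have := coneR_ge0 p; rewrite le_eqVlt => /orP[/eqP/esym p0|p0]; last by left.
    by right.
  by move=> [[]|[_ []]].
apply: measurableU; first by apply: cone_open_measurable; exact: cone_open_coneX.
have [[v [v0 Uv]]|h] := pselect (exists v : C, coneR v = 0 /\ U (coneX v)).
  rewrite (_ : _ `&` _ = [set p : C | coneR p = 0])//.
  apply/seteqP; split => [p []//|p p0]; split => //; split => //.
  by rewrite (coneR0_eq p0 v0).
rewrite (_ : _ `&` _ = set0)//; apply/seteqP; split => // p [_ hp]; apply: h.
by exists p.
Qed.

Lemma continuous_measurable_body (f : X -> R) : continuous f -> measurable_fun [set: X] f.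
Proof.
move=> /continuousP cf.
apply: (measurability _ (RGenOInfty.measurableE R)) => _ [_ [a ->] <-].
rewrite setTI; apply: sub_sigma_algebra; apply: cf; exact: interval_open.
Qed.

Lemma continuous_coord (i : 'I_d) : continuous (fun x : X => val x 0 i : R).
Proof.
move=> x; apply: (@continuous_comp X 'rV[R]_d R val (fun M : 'rV[R]_d => M 0 i)).
  exact: initial_continuous.
exact: coord_continuous.
Qed.

Lemma continuous_bdist y : continuous (fun x : X => bdist x y).
Proof.
move=> x; apply: (@continuous_comp X 'rV[R]_d R val (fun z => euclid_dist z (val y))).
  exact: initial_continuous.
exact: continuous_euclid_dist.
Qed.

Lemma continuous_min_pihalf : continuous (fun u : R => Num.min u (pi / 2)).
Proof. by move=> u; apply: (@continuous_min R R id (cst _) u); [exact: cvg_id|exact: cvg_cst]. Qed.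

Lemma continuous_tcos y : continuous (fun x : X => tcos (bdist x y)).
Proof.
move=> x; apply: (@continuous_comp X R R (fun z => Num.min (bdist z y) (pi / 2))).
  apply: (@continuous_comp X R R (fun z => bdist z y) (fun u => Num.min u (pi / 2))).
    exact: continuous_bdist.
  exact: continuous_min_pihalf.
exact: continuous_cos.
Qed.

Lemma measurable_cone_dist_sqr :
  measurable_fun [set: C * C] (fun pq : C * C => cone_dist pq.1 pq.2 ^+ 2).
Proof.
have m1 : measurable_fun [set: C * C] (fun pq : C * C => coneR pq.1).
  exact: (measurableT_comp measurable_coneR measurable_fst).
have m2 : measurable_fun [set: C * C] (fun pq : C * C => coneR pq.2).
  exact: (measurableT_comp measurable_coneR measurable_snd).
under eq_fun do rewrite cone_dist_sqr.
apply: measurable_funB; first by apply: measurable_funD; exact: measurable_funX.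
apply: measurable_funM; first by apply: measurable_funM => //; exact: measurable_funM.
rewrite /cos_pi.
apply: (measurableT_comp (continuous_measurable_fun (@continuous_cos R))).
apply: measurable_minr => //.
rewrite /bdist /euclid_dist.
apply: (measurableT_comp (continuous_measurable_fun (@sqrt_continuous R))).
apply: measurable_sum => i; apply: measurable_funX; apply: measurable_funB.
- have := measurableT_comp (continuous_measurable_body (@continuous_coord i)) (measurableT_comp measurable_coneX (@measurable_fst _ _ C C)).
  exact.
- have := measurableT_comp (continuous_measurable_body (@continuous_coord i)) (measurableT_comp measurable_coneX (@measurable_snd _ _ C C)).
  exact.
Qed.

Lemma measurable_coneR2M (phi : X -> R) : measurable_fun [set: X] phi ->
  measurable_fun [set: C] (fun p : C => coneR p ^+ 2 * phi (coneX p)).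
Proof.
move=> mphi; apply: measurable_funM.
  by apply: measurable_funX; exact: measurable_coneR.
exact: (measurableT_comp mphi measurable_coneX).
Qed.

End cone_theory.

(** * Bounds on the Hellinger-Kantorovich distance *)

Section measure_add_finite.
Context {disp : measure_display} {T : measurableType disp} {R : realType}.
Variables mu nu : {finite_measure set T -> \bar R}.

Definition fmeasure_add : set T -> \bar R := measure_add mu nu.

HB.instance Definition _ := Measure.on fmeasure_add.

Let fin_num_fmeasure_add : fin_num_fun fmeasure_add.
Proof.
move=> A mA; rewrite /fmeasure_add measure_addE fin_numD.
by rewrite !fin_num_measure.
Qed.

HB.instance Definition _ := Measure_isFinite.Build _ T _ fmeasure_add fin_num_fmeasure_add.

Lemma fmeasure_addE A : fmeasure_add A = (mu A + nu A)%E.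
Proof. exact: measure_addE. Qed.

End measure_add_finite.

Section hk_bounds.
Context {R : realType} {d : nat} {Omega : set 'rV[R]_d} {x0 : Omega}.
Local Notation X := (body x0).
Local Notation C := (cone x0).
Local Notation fm T := {finite_measure set T -> \bar R}.
Implicit Types (mu nu : fm X) (lam : fm C) (gam : {measure set (C * C)%type -> \bar R}).

Lemma continuous_integrable mu (f : X -> R) (K : R) : continuous f ->
  (forall x, `|f x| <= K) -> mu.-integrable setT (EFin \o f).
Proof.
move=> cf fK; apply: measurable_bounded_integrable => //.
- by rewrite -ge0_fin_numE// fin_num_measure.
- exact: continuous_measurable_body.
- exists K; split; first exact: num_real.
  by move=> M KM x _ /=; apply: (le_trans (fK x)); exact: ltW.
Qed.

(** Positive and negative parts of a continuous function are continuous, and the factor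
    [coneR p ^+ 2] commutes with taking them. With nonnegative test functions, integrals against
    sums and multiples of measures split freely. *)
Lemma is_projection_ge0 lam mu :
  (forall phi : X -> R, continuous phi -> (forall x, 0 <= phi x) ->
    (\int[mu]_x (phi x)%:E = \int[lam]_p (coneR p ^+ 2 * phi (coneX p))%:E)%E) ->
  is_projection lam mu.
Proof.
have aux (phi : X -> R) : continuous phi -> continuous (fun x => Num.max (phi x) 0).
  move=> cphi x; apply: (@continuous_max R X phi (cst 0) x); first exact: cphi.
  exact: cst_continuous.
move=> h phi cphi; rewrite integralE [RHS]integralE.
congr (_ - _)%E.
- transitivity (\int[mu]_x (Num.max (phi x) 0)%:E)%E.
    by apply: eq_integral => x _; rewrite funeposE -fine_max.
  rewrite (h _ (aux _ cphi)); last by move=> x; rewrite le_max lexx orbT.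
  apply: eq_integral => p _; rewrite funeposE -fine_max//=.
  by rewrite maxr_pMr ?sqr_ge0// mulr0.
- transitivity (\int[mu]_x (Num.max (- phi x) 0)%:E)%E.
    by apply: eq_integral => x _; rewrite funenegE -fine_max.
  have cN : continuous (fun x => - phi x).
    by move=> x; apply: (@continuousN R R^o X phi x); exact: cphi.
  rewrite (h _ (aux _ cN)); last by move=> x; rewrite le_max lexx orbT.
  apply: eq_integral => p _; rewrite funenegE -fine_max//=.
  by rewrite maxr_pMr ?sqr_ge0// mulr0 mulrN.
Qed.

Lemma measurable_lift (phi : X -> R) : continuous phi ->
  measurable_fun setT (fun p : C => (coneR p ^+ 2 * phi (coneX p))%:E).
Proof.
move=> cphi; apply/measurable_EFinP.
exact: (measurable_coneR2M (continuous_measurable_body cphi)).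
Qed.

Lemma lifts_add mu nu lam lam' : lifts mu lam -> lifts nu lam' ->
  lifts (fmeasure_add mu nu) (fmeasure_add lam lam').
Proof.
move=> [M hp] [M' hp']; split.
  rewrite /M2/= ge0_integral_measure_add//; first exact: lte_add_pinfty.
  - by move=> p _; rewrite lee_fin sqr_ge0.
  - by apply/measurable_EFinP; apply: measurable_funX; exact: measurable_coneR.
apply: is_projection_ge0 => phi cphi phi0.
rewrite !ge0_integral_measure_add//; first by rewrite hp// hp'.
- by move=> p _; rewrite lee_fin mulr_ge0// sqr_ge0.
- exact: measurable_lift.
- by move=> x _; rewrite lee_fin.
- by apply/measurable_EFinP; exact: continuous_measurable_body.
Qed.

Lemma lifts_mscale (a : {nonneg R}) mu lam : lifts mu lam ->
  lifts (mscale a mu) (mscale a lam).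
Proof.
move=> [M hp]; split.
  rewrite /M2/= ge0_integral_mscale//; first exact: lte_mul_pinfty.
  - by apply/measurable_EFinP; apply: measurable_funX; exact: measurable_coneR.
  - by move=> p _; rewrite lee_fin sqr_ge0.
apply: is_projection_ge0 => phi cphi phi0.
rewrite !ge0_integral_mscale//; first by rewrite hp.
- exact: measurable_lift.
- by move=> p _; rewrite lee_fin mulr_ge0// sqr_ge0.
- by apply/measurable_EFinP; exact: continuous_measurable_body.
- by move=> x _; rewrite lee_fin.
Qed.

Lemma lifts_dirac (x : X) (r : {nonneg R}) :
  lifts (mscale (r%:num ^+ 2)%:nng \d_x) \d_(cone_pt x r).
Proof.
split.
  rewrite /M2/= integral_dirac//; last first.
    by apply/measurable_EFinP; apply: measurable_funX; exact: measurable_coneR.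
  by rewrite diracT mul1e ltry.
apply: is_projection_ge0 => phi cphi phi0.
have mphi : measurable_fun setT (EFin \o phi).
  by apply/measurable_EFinP; exact: continuous_measurable_body.
rewrite ge0_integral_mscale// ?integral_dirac//; first last.
- by move=> y _; rewrite lee_fin.
- exact: measurable_lift.
rewrite !diracT !mul1e coneR_pt -EFinM; congr EFin.
change (r%:num ^+ 2 * phi x = r%:num ^+ 2 * phi (coneX (cone_pt x r))).
(* At the vertex the base point is arbitrary, but the weight is 0. *)
have [r0|r0] := eqVneq r%:num 0; first by rewrite r0 expr0n/= !mul0r.
by rewrite coneX_pt.
Qed.

Lemma lifts_eq mu mu' : (forall A, measurable A -> mu A = mu' A) ->
  lifts mu = lifts mu'.
Proof.
move=> h; apply/seteqP; split => lam [M hp]; split => // phi cphi.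
  by rewrite -hp//; apply: eq_measure_integral => A mA _; exact/esym/h.
by rewrite -hp//; apply: eq_measure_integral => A mA _; exact: h.
Qed.

Definition cost gam : \bar R := (\int[gam]_pq (cone_dist pq.1 pq.2 ^+ 2)%:E)%E.

Lemma cost_ge0 gam : (0 <= cost gam)%E.
Proof. by apply: integral_ge0 => pq _; rewrite lee_fin sqr_ge0. Qed.

Lemma measurable_cost :
  measurable_fun setT (fun pq : C * C => (cone_dist pq.1 pq.2 ^+ 2)%:E).
Proof. by apply/measurable_EFinP; exact: measurable_cone_dist_sqr. Qed.

Lemma HK_ge mu nu (K : R) :
  (forall lam0 lam1 gam, lifts mu lam0 -> lifts nu lam1 -> coupling lam0 lam1 gam ->
    (K%:E <= cost gam)%E) ->
  ((Num.sqrt K)%:E <= HK mu nu)%E.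
Proof.
move=> h; apply: le_ereal_inf_tmp => _ [lam0 l0 [lam1 l1 <-]].
rewrite (_ : (Num.sqrt K)%:E = sqrte K%:E)// lee_sqrt.
  by apply: le_ereal_inf_tmp => _ [gam g <-]; exact: (h lam0 lam1).
by apply: le_ereal_inf_tmp => _ [gam g <-]; exact: cost_ge0.
Qed.

Lemma HK_ge0 mu nu : (0 <= HK mu nu)%E.
Proof. by apply: le_ereal_inf_tmp => _ [lam0 l0 [lam1 l1 <-]]; exact: sqrte_ge0. Qed.

Lemma HK_le mu nu lam0 lam1 gam (K : R) : 0 <= K ->
  lifts mu lam0 -> lifts nu lam1 -> coupling lam0 lam1 gam ->
  (cost gam <= K%:E)%E -> (HK mu nu <= (Num.sqrt K)%:E)%E.
Proof.
move=> K0 l0 l1 g h; apply: ge_ereal_inf; exists (W_cone lam0 lam1).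
  by exists lam0 => //; exists lam1.
rewrite (_ : (Num.sqrt K)%:E = sqrte K%:E)// lee_sqrt ?lee_fin//.
by apply: ge_ereal_inf; exists (cost gam) => //; exists gam.
Qed.

(* [HK mu nu ^ 2 <= K], in a form stable under sums and scaling of measures. *)
Definition HK2_le mu nu (K : R) : Prop := forall e : R, 0 < e ->
  exists lam0 lam1 gam, [/\ lifts mu lam0, lifts nu lam1, coupling lam0 lam1 gam
    & (cost gam <= (K + e)%:E)%E].

Lemma HK2_leP mu nu K : 0 <= K -> HK2_le mu nu K <-> (HK mu nu <= (Num.sqrt K)%:E)%E.
Proof.
move=> K0; split => h.
  apply/lee_addgt0Pr => e e0.
  (* The tolerance is [e ^+ 2] because sqrt (K + e^2) <= sqrt K + e. *)
  have [lam0 [lam1 [gam [l0 l1 g c]]]] := h (e ^+ 2) (exprn_gt0 2 e0).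
  apply: (le_trans (HK_le _ l0 l1 g c)); first by rewrite addr_ge0// sqr_ge0.
  rewrite -EFinD lee_fin -(@ler_pXn2r _ 2) ?nnegrE ?addr_ge0 ?sqrtr_ge0 ?(ltW e0)//.
  rewrite sqrrD !sqr_sqrtr ?addr_ge0 ?sqr_ge0//.
  by rewrite lerD2r lerDl mulrn_wge0// mulr_ge0 ?sqrtr_ge0// ltW.
(* If every plan cost more than [K + e], then [HK] would be at least sqrt (K + e) > sqrt K. *)
move=> e e0; apply: contrapT => hn.
have : ((Num.sqrt (K + e))%:E <= HK mu nu)%E.
  apply: HK_ge => lam0 lam1 gam l0 l1 g; rewrite leNgt; apply/negP => c; apply: hn.
  by exists lam0, lam1, gam; split => //; exact: ltW.
move=> /le_trans/(_ h); rewrite lee_fin ler_sqrt//.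
by rewrite leNgt ltrDl e0.
Qed.

Lemma HK2_le_add mu nu mu' nu' K K' : HK2_le mu nu K -> HK2_le mu' nu' K' ->
  HK2_le (fmeasure_add mu mu') (fmeasure_add nu nu') (K + K').
Proof.
move=> h h' e e0.
have e2 : 0 < e / 2 by rewrite divr_gt0.
have [lam0 [lam1 [gam [l0 l1 g c]]]] := h _ e2.
have [lam0' [lam1' [gam' [l0' l1' g' c']]]] := h' _ e2.
exists (fmeasure_add lam0 lam0'), (fmeasure_add lam1 lam1'), (measure_add gam gam').
split; [exact: lifts_add|exact: lifts_add| |].
  move=> A mA; have [g0 g1] := g A mA; have [g0' g1'] := g' A mA.
  have E (f : C * C -> C) : pushforward (measure_add gam gam') f A =
    (pushforward gam f A + pushforward gam' f A)%E by exact: measure_addE.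
  by rewrite !E g0 g1 g0' g1'; split; exact/esym/measure_addE.
rewrite /cost ge0_integral_measure_add//; last exact: measurable_cost.
- apply: (le_trans (leeD c c')); rewrite -EFinD lee_fin; lra.
- by move=> pq _; rewrite lee_fin sqr_ge0.
Qed.

Lemma HK2_le_mscale (a : {nonneg R}) mu nu K : HK2_le mu nu K ->
  HK2_le (mscale a mu) (mscale a nu) (a%:num * K).
Proof.
move=> h e e0.
(* [a] may be 0, so the tolerance is divided by [a + 1]. *)
have a1 : 0 < a%:num + 1 by rewrite ltr_wpDl.
have [lam0 [lam1 [gam [l0 l1 g c]]]] := h _ (divr_gt0 e0 a1).
exists (mscale a lam0), (mscale a lam1), (mscale a gam).
split; [exact: lifts_mscale|exact: lifts_mscale| |].
  by move=> A mA; have [g0 g1] := g A mA; split;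
    [exact: (congr1 (fun z => a%:num%:E * z)%E g0)|exact: (congr1 (fun z => a%:num%:E * z)%E g1)].
rewrite /cost ge0_integral_mscale//; [|exact: measurable_cost|]; last first.
  by move=> pq _; rewrite lee_fin sqr_ge0.
apply: (le_trans (lee_wpmul2l _ c)); first by rewrite lee_fin.
rewrite -EFinM lee_fin mulrDr lerD2l mulrCA ger_pMr//.
by rewrite ler_pdivrMr// mul1r lerDl.
Qed.

Lemma HK2_le_dirac (x y : X) (r s : {nonneg R}) :
  HK2_le (mscale (r%:num ^+ 2)%:nng \d_x) (mscale (s%:num ^+ 2)%:nng \d_y)
    (r%:num ^+ 2 + s%:num ^+ 2 - 2 * r%:num * s%:num * cos_pi (bdist x y)).
Proof.
move=> e e0; exists \d_(cone_pt x r), \d_(cone_pt y s), \d_(cone_pt x r, cone_pt y s).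
split; [exact: lifts_dirac|exact: lifts_dirac|by move=> A mA|].
rewrite /cost integral_dirac//; last exact: measurable_cost.
by rewrite diracT mul1e/= lee_fin cone_dist_pt lerDl ltW.
Qed.

Lemma HK2_le_eq mu mu' nu nu' K : (forall A, measurable A -> mu A = mu' A) ->
  (forall A, measurable A -> nu A = nu' A) -> HK2_le mu nu K -> HK2_le mu' nu' K.
Proof.
move=> h h' hk e /hk [lam0 [lam1 [gam [l0 l1 g c]]]]; exists lam0, lam1, gam.
by rewrite -(lifts_eq h) -(lifts_eq h').
Qed.

Lemma coupling_fst lam0 lam1 gam (g : C -> \bar R) : coupling lam0 lam1 gam ->
  measurable_fun setT g -> (forall p, 0 <= g p)%E ->
  (\int[lam0]_p g p = \int[gam]_pq g pq.1)%E.
Proof.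
move=> hg mg g0; rewrite -(ge0_integral_pushforward (@measurable_fst _ _ C C) gam measurableT)//.
by apply: eq_measure_integral => A mA _; exact: (esym (hg A mA).1).
Qed.

Lemma coupling_snd lam0 lam1 gam (g : C -> \bar R) : coupling lam0 lam1 gam ->
  measurable_fun setT g -> (forall p, 0 <= g p)%E ->
  (\int[lam1]_p g p = \int[gam]_pq g pq.2)%E.
Proof.
move=> hg mg g0; rewrite -(ge0_integral_pushforward (@measurable_snd _ _ C C) gam measurableT)//.
by apply: eq_measure_integral => A mA _; exact: (esym (hg A mA).2).
Qed.

(* Weak duality; the potentials are [1 - f] and [1 - g], and [F], [G] penalize
   the complements of sets on which [mu] and [nu] are concentrated. *)
Lemma HK_dual mu nu (f g F G : X -> R) (K : R) :
  continuous f -> continuous g -> continuous F -> continuous G ->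
  (forall x, 0 <= f x <= K) -> (forall x, 0 <= g x <= K) ->
  (forall x, 0 <= F x) -> (forall x, 0 <= G x) ->
  (\int[mu]_x (F x)%:E = 0)%E -> (\int[nu]_x (G x)%:E = 0)%E ->
  (forall x y (r s : R), 0 <= r -> 0 <= s -> F x = 0 -> G y = 0 ->
    2 * r * s * cos_pi (bdist x y) <= f x * r ^+ 2 + g y * s ^+ 2) ->
  ((Num.sqrt (fine (mu setT) + fine (nu setT)
     - \int[mu]_x f x - \int[nu]_x g x))%:E <= HK mu nu)%E.
Proof.
move=> cf cg cF cG fK gK F0 G0 muF nuG h.
have intf : mu.-integrable setT (EFin \o f).
  by apply: (@continuous_integrable _ _ K) => // x; have /andP[? ?] := fK x; rewrite ger0_norm.
have intg : nu.-integrable setT (EFin \o g).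
  by apply: (@continuous_integrable _ _ K) => // x; have /andP[? ?] := gK x; rewrite ger0_norm.
apply: HK_ge => lam0 lam1 gam [_ l0] [_ l1] hg.
have cst1 : continuous (fun _ : X => 1 : R) by exact: cst_continuous.
have p0 (phi : X -> R) : (forall x, 0 <= phi x) -> forall p : C, (0 <= (coneR p ^+ 2 * phi (coneX p))%:E)%E.
  by move=> phi0 p; rewrite lee_fin mulr_ge0// sqr_ge0.
have f0 x : 0 <= f x by have /andP[] := fK x.
have g0 x : 0 <= g x by have /andP[] := gK x.
have L0 (phi : X -> R) : continuous phi -> (forall x, 0 <= phi x) ->
    (\int[mu]_x (phi x)%:E = \int[gam]_pq (coneR pq.1 ^+ 2 * phi (coneX pq.1))%:E)%E.
  move=> cphi phi0; rewrite l0//; apply: (coupling_fst hg (measurable_lift cphi)).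
  exact: p0.
have L1 (phi : X -> R) : continuous phi -> (forall x, 0 <= phi x) ->
    (\int[nu]_x (phi x)%:E = \int[gam]_pq (coneR pq.2 ^+ 2 * phi (coneX pq.2))%:E)%E.
  move=> cphi phi0; rewrite l1//; apply: (coupling_snd hg (measurable_lift cphi)).
  exact: p0.
have m1 (phi : X -> R) : continuous phi ->
    measurable_fun setT (fun pq : C * C => (coneR pq.1 ^+ 2 * phi (coneX pq.1))%:E).
  by move=> cphi; exact: (measurableT_comp (measurable_lift cphi) measurable_fst).
have m2 (phi : X -> R) : continuous phi ->
    measurable_fun setT (fun pq : C * C => (coneR pq.2 ^+ 2 * phi (coneX pq.2))%:E).
  by move=> cphi; exact: (measurableT_comp (measurable_lift cphi) measurable_snd).
have massE (nu' : fm X) : (\int[nu']_x (1 : R)%:E)%E = nu' setT.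
  by rewrite integral_cst// mul1e.
(* Additive form in the extended reals, so that an infinite cost causes no subtraction. Masses are
   integrals of 1; the projection conditions turn all terms into integrals against [gam], where the
   comparison is pointwise. *)
have main : (mu setT + nu setT <=
    cost gam + \int[mu]_x (f x)%:E + \int[nu]_x (g x)%:E)%E.
  rewrite -(massE mu) -(massE nu) L0// L1// (L0 f)// (L1 g)// /cost.
  rewrite -!ge0_integralD//; first last.
  all: try by move=> pq _; exact: (p0 _ (fun=> ler01)).
  all: try by move=> pq _; exact: (p0 f f0).
  all: try by move=> pq _; exact: (p0 g g0).
  all: try exact: (m1 _ cst1).
  all: try exact: (m2 _ cst1).
  all: try exact: (m1 f cf).
  all: try exact: (m2 g cg).
  all: try exact: measurable_cost.
  all: try by move=> pq _; rewrite lee_fin sqr_ge0.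
  all: try by apply: emeasurable_funD; [exact: measurable_cost|exact: (m1 f cf)].
  all: try by move=> pq _; apply: adde_ge0; [rewrite lee_fin sqr_ge0|exact: (p0 f f0)].
  (* [gam]-almost every pair has its first point at the vertex or over a zero of [F]; likewise for
     [G] below. *)
  have aeF : ae_eq gam setT (fun pq : C * C => (coneR pq.1 ^+ 2 * F (coneX pq.1))%:E) (cst 0%E).
    apply/ae_eq_integral_abs => //; first exact: m1.
    rewrite -muF L0//; apply: eq_integral => pq _; rewrite gee0_abs//; exact: (p0 F F0).
  have aeG : ae_eq gam setT (fun pq : C * C => (coneR pq.2 ^+ 2 * G (coneX pq.2))%:E) (cst 0%E).
    apply/ae_eq_integral_abs => //; first exact: m2.
    rewrite -nuG L1//; apply: eq_integral => pq _; rewrite gee0_abs//; exact: (p0 G G0).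
  apply: ae_ge0_le_integral => //.
  - by move=> pq _; apply: adde_ge0; exact: (p0 _ (fun=> ler01)).
  - by apply: emeasurable_funD; [exact: (m1 _ cst1)|exact: (m2 _ cst1)].
  - move=> pq _; apply: adde_ge0; last exact: (p0 g g0).
    by apply: adde_ge0; [rewrite lee_fin sqr_ge0|exact: (p0 f f0)].
  - apply: emeasurable_funD; last exact: (m2 g cg).
    by apply: emeasurable_funD; [exact: measurable_cost|exact: (m1 f cf)].
  apply: filterS2 aeF aeG => -[p q]/= /(_ I)[/eqP hF] /(_ I)[/eqP hG] _.
  rewrite -!EFinD lee_fin cone_dist_sqr !mulr1.
  suff : 2 * coneR p * coneR q * cos_pi (bdist (coneX p) (coneX q)) <=
    f (coneX p) * coneR p ^+ 2 + g (coneX q) * coneR q ^+ 2 by lra.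
  move: hF hG; rewrite !mulf_eq0 !orbb.
  (* At the vertex nothing is known about [F], but the cross term vanishes and the right side is
     nonnegative. *)
  have [->|pn0] := eqVneq (coneR p) 0.
    by move=> _ _; rewrite !(mulr0, mul0r) expr0n/= mulr0 add0r mulr_ge0// sqr_ge0.
  have [->|qn0] := eqVneq (coneR q) 0.
    by move=> _ _; rewrite !(mulr0, mul0r) expr0n/= mulr0 addr0 mulr_ge0// sqr_ge0.
  by move=> /= /eqP hF /eqP hG; apply: h => //; exact: coneR_ge0.
have fE : (\int[mu]_x (f x)%:E)%E = (\int[mu]_x f x)%:E.
  by rewrite fineK//; exact: integrable_fin_num.
have gE : (\int[nu]_x (g x)%:E)%E = (\int[nu]_x g x)%:E.
  by rewrite fineK//; exact: integrable_fin_num.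
move: main; rewrite fE gE -(fineK (fin_num_measure mu setT measurableT)).
rewrite -(fineK (fin_num_measure nu setT measurableT)).
have := cost_ge0 gam; case: (cost gam) => [c _|_ _|//]; last by rewrite leey.
by rewrite -!EFinD !lee_fin; lra.
Qed.

End hk_bounds.

(** * Lower bounds from explicit dual potentials *)

Section lower_bounds.
Context {R : realType} {d : nat} {Omega : set 'rV[R]_d} {x0 : Omega}.
Local Notation X := (body x0).
Local Notation fm T := {finite_measure set T -> \bar R}.
Implicit Types (mu nu : fm X) (x y z : X).

Lemma bdistC x y : bdist x y = bdist y x. Proof. exact: euclid_distC. Qed.

Lemma bdistxx x : bdist x x = 0. Proof. exact: euclid_distxx. Qed.

Lemma bdist_triangle x y z : bdist x z <= bdist x y + bdist y z.
Proof. exact: euclid_dist_triangle. Qed.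

Lemma bdist0_eq x y : bdist x y = 0 -> x = y.
Proof. by move=> /euclid_dist0_eq /val_inj. Qed.

Definition mass mu : R := fine (mu setT).

Definition tcos_mass y mu : R := \int[mu]_x (tcos (bdist x y) ^+ 2).

Lemma continuous_tcos2 y : continuous (fun x : X => tcos (bdist x y) ^+ 2).
Proof.
move=> x; apply: (@continuous_comp X R R (fun x => tcos (bdist x y)) (fun u => u ^+ 2)).
  exact: continuous_tcos.
exact: exprn_continuous.
Qed.

Lemma tcos2_itv x y : 0 <= tcos (bdist x y) ^+ 2 <= 1.
Proof. by rewrite sqr_ge0 expr_le1 ?tcos_le1 ?tcos_ge0 ?bdist_ge0. Qed.

Lemma tcos2_integrable y mu : mu.-integrable setT (EFin \o (fun x => tcos (bdist x y) ^+ 2)).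
Proof.
apply: (@continuous_integrable _ _ _ _ _ _ 1); first exact: continuous_tcos2.
by move=> x; rewrite ger0_norm ?sqr_ge0//; have /andP[] := tcos2_itv x y.
Qed.

Lemma tcos_mass_ge0 y mu : 0 <= tcos_mass y mu.
Proof. by apply: Rintegral_ge0 => x _; exact: sqr_ge0. Qed.

(** The three-dimensional space containing all potentials, penalties and the gap function of the
    uniqueness argument; integrals over it only see [mass] and two values of [tcos_mass]. *)
Definition qform (k a b : R) y0 y1 (x : X) : R :=
  k + a * tcos (bdist x y0) ^+ 2 + b * tcos (bdist x y1) ^+ 2.

Lemma continuous_qform k a b y0 y1 : continuous (qform k a b y0 y1).
Proof.
move=> x; apply: (@continuousD R R^o X (fun x => k + a * tcos (bdist x y0) ^+ 2) (fun x => b * tcos (bdist x y1) ^+ 2)).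
  apply: (@continuousD R R^o X (cst k) (fun x => a * tcos (bdist x y0) ^+ 2)).
    exact: cst_continuous.
  apply: (@continuousM R X (cst a) (fun x => tcos (bdist x y0) ^+ 2)).
    exact: cst_continuous.
  exact: continuous_tcos2.
apply: (@continuousM R X (cst b) (fun x => tcos (bdist x y1) ^+ 2)).
  exact: cst_continuous.
exact: continuous_tcos2.
Qed.

Lemma qform_bound k a b y0 y1 x : `|qform k a b y0 y1 x| <= `|k| + `|a| + `|b|.
Proof.
have /andP[h0 h1] := tcos2_itv x y0; have /andP[h0' h1'] := tcos2_itv x y1.
rewrite /qform; apply: (le_trans (ler_normD _ _)); apply: lerD; last first.
  by rewrite normrM ler_piMr// ger0_norm.
apply: (le_trans (ler_normD _ _)); rewrite lerD2l.
by rewrite normrM ler_piMr// ger0_norm.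
Qed.

Lemma qform_integrable k a b y0 y1 mu : mu.-integrable setT (EFin \o qform k a b y0 y1).
Proof.
apply: continuous_integrable; first exact: continuous_qform.
by move=> x; exact: qform_bound.
Qed.

Lemma Rintegral_qform k a b y0 y1 mu :
  \int[mu]_x qform k a b y0 y1 x =
  k * mass mu + a * tcos_mass y0 mu + b * tcos_mass y1 mu.
Proof.
have ia a' y : mu.-integrable setT (EFin \o (fun x => a' * tcos (bdist x y) ^+ 2)).
  rewrite (_ : _ \o _ = (fun x => a'%:E * (tcos (bdist x y) ^+ 2)%:E)%E)//.
  by apply: integrableZl => //; exact: tcos2_integrable.
have ik : mu.-integrable setT (EFin \o cst k) by exact: finite_measure_integrable_cst.
rewrite RintegralD//; last exact: (integrableD measurableT ik (ia a y0)).
rewrite RintegralD//.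
rewrite !RintegralZl ?Rintegral_cst//; exact: tcos2_integrable.
Qed.

Lemma integral_qform_eq0 k a b y0 y1 mu : (\int[mu]_x qform k a b y0 y1 x)%R = 0 ->
  (\int[mu]_x (qform k a b y0 y1 x)%:E = 0)%E.
Proof.
move=> h; rewrite -[LHS]fineK; first by rewrite -[fine _]/(Rintegral _ _ _) h.
by apply: integrable_fin_num => //; exact: qform_integrable.
Qed.

(** Weak duality solved for the squared distance: the square root is removed once and for all, a
    negative left side being trivially below [h ^+ 2]. *)
Lemma HK_qform_dual mu nu (k a b k' a' b' K K' K'' L0 L1 L2 h : R) y0 y1 z0 z1 w0 w1 w0' w1' :
  HK mu nu = h%:E -> 0 <= h ->
  let f := qform k a b y0 y1 in let g := qform k' a' b' z0 z1 in
  let F := qform K K' K'' w0 w1 in let G := qform L0 L1 L2 w0' w1' in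
  (forall x, 0 <= f x) -> (forall x, 0 <= g x) ->
  (forall x, 0 <= F x) -> (forall x, 0 <= G x) ->
  \int[mu]_x F x = 0 -> \int[nu]_x G x = 0 ->
  (forall x y (r s : R), 0 <= r -> 0 <= s -> F x = 0 -> G y = 0 ->
    2 * r * s * cos_pi (bdist x y) <= f x * r ^+ 2 + g y * s ^+ 2) ->
  mass mu + mass nu - \int[mu]_x f x - \int[nu]_x g x <= h ^+ 2.
Proof.
move=> hk h0 f g F G f0 g0 F0 G0 muF nuG H.
have := @HK_dual _ _ _ _ mu nu f g F G (Num.max (`|k| + `|a| + `|b|) (`|k'| + `|a'| + `|b'|)).
rewrite hk lee_fin => /(_ (@continuous_qform _ _ _ _ _) (@continuous_qform _ _ _ _ _) (@continuous_qform _ _ _ _ _) (@continuous_qform _ _ _ _ _)).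
have fK x : 0 <= f x <= Num.max (`|k| + `|a| + `|b|) (`|k'| + `|a'| + `|b'|).
  by rewrite f0 le_max -[f x]ger0_norm// qform_bound.
have gK x : 0 <= g x <= Num.max (`|k| + `|a| + `|b|) (`|k'| + `|a'| + `|b'|).
  by rewrite g0 le_max -[g x]ger0_norm// qform_bound orbT.
move=> /(_ fK gK F0 G0 (integral_qform_eq0 muF) (integral_qform_eq0 nuG) H).
rewrite -/(mass _) -/(mass _); set S := _ - _.
have [S0|S0] := leP 0 S; last by move=> _; apply: (le_trans (ltW S0)); exact: sqr_ge0.
by rewrite -(@ler_pXn2r _ 2) ?nnegrE ?sqrtr_ge0// sqr_sqrtr.
Qed.

Lemma tcos_eq1 (u : R) : 0 <= u -> tcos u ^+ 2 = 1 -> u = 0.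
Proof.
move=> u0 h; have /andP[m0 m1] := min_pihalf u0; have p0 := pi_gt0 R.
have : Num.min u (pi / 2) = 0.
  apply: (@cos_inj R); rewrite ?in_itv/= ?lexx ?m0 ?pi_ge0//; first lra.
  rewrite cos0 -/(tcos u); apply: (@pexpIrn R 2) => //; rewrite ?nnegrE ?tcos_ge0 ?ler01//.
  by rewrite expr1n.
by rewrite /Num.min; case: ifP => // _ ?; lra.
Qed.

Lemma Rintegral_eq_measure mu nu (f : X -> R) : (forall A, measurable A -> mu A = nu A) ->
  \int[mu]_x f x = \int[nu]_x f x.
Proof. by move=> h; rewrite /Rintegral; congr fine; apply: eq_measure_integral => A mA _; exact: h. Qed.

Lemma integral_mscale_dirac (w : {nonneg R}) z (f : X -> R) : continuous f -> (forall x, 0 <= f x) ->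
  (\int[mscale w \d_z]_x (f x)%:E = (w%:num * f z)%:E)%E.
Proof.
move=> cf f0; have mf : measurable_fun setT (EFin \o f).
  by apply/measurable_EFinP; exact: continuous_measurable_body.
rewrite ge0_integral_mscale ?integral_dirac//; last by move=> x _; rewrite lee_fin.
by rewrite diracT mul1e.
Qed.

Definition two_dirac (w0 w1 : {nonneg R}) z0 z1 : fm X :=
  fmeasure_add (mscale w0 \d_z0) (mscale w1 \d_z1).

Lemma two_diracE w0 w1 z0 z1 A : two_dirac w0 w1 z0 z1 A =
  (w0%:num * (z0 \in A)%:R + w1%:num * (z1 \in A)%:R)%:E.
Proof.
rewrite (_ : two_dirac w0 w1 z0 z1 A = (mscale w0 \d_z0 A + mscale w1 \d_z1 A)%E); last exact: fmeasure_addE.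
by rewrite /mscale /= /dirac !indicE -!EFinM -EFinD.
Qed.

Lemma Rintegral_two_dirac w0 w1 z0 z1 (f : X -> R) : continuous f -> (forall x, 0 <= f x) ->
  \int[two_dirac w0 w1 z0 z1]_x f x = w0%:num * f z0 + w1%:num * f z1.
Proof.
move=> cf f0; have mf : measurable_fun setT (EFin \o f).
  by apply/measurable_EFinP; exact: continuous_measurable_body.
rewrite /Rintegral ge0_integral_measure_add//; last by move=> x _; rewrite lee_fin.
by rewrite !integral_mscale_dirac.
Qed.

Lemma tcos_mass_two_dirac w0 w1 z0 z1 y : tcos_mass y (two_dirac w0 w1 z0 z1) =
  w0%:num * tcos (bdist z0 y) ^+ 2 + w1%:num * tcos (bdist z1 y) ^+ 2.
Proof.
rewrite /tcos_mass (Rintegral_two_dirac _ _ _ _ (@continuous_tcos2 y))// => x.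
exact: sqr_ge0.
Qed.

Lemma mass_two_dirac w0 w1 z0 z1 : mass (two_dirac w0 w1 z0 z1) = w0%:num + w1%:num.
Proof. by rewrite /mass two_diracE !in_setT !mulr1. Qed.

Lemma tcos_mass_eq y mu nu : (forall A, measurable A -> mu A = nu A) ->
  tcos_mass y mu = tcos_mass y nu.
Proof. exact: Rintegral_eq_measure. Qed.

Lemma mass_eq mu nu : (forall A, measurable A -> mu A = nu A) -> mass mu = mass nu.
Proof. by move=> h; congr fine; exact: h. Qed.

Lemma measurable_singleton z : measurable [set z].
Proof.
have := continuous_measurable_body (@continuous_bdist _ _ _ x0 z).
move=> /(_ measurableT _ (measurable_set1 0)); rewrite setTI.
congr measurable; apply/seteqP; split => x /=; first exact: bdist0_eq.
by move=> ->; exact: bdistxx.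
Qed.

Lemma two_dirac_measure mu z0 z1 : mu (~` [set z0; z1]) = 0%E ->
  exists w0 w1, forall A, measurable A -> mu A = two_dirac w0 w1 z0 z1 A.
Proof.
move=> h; have m0 := measurable_singleton z0; have m1 := measurable_singleton z1.
(* Removing [z0] from the second atom avoids counting its mass twice when [z0 = z1], a case used for
   measures with a single atom. *)
have m01 : measurable ([set z1] `\` [set z0]) by exact: measurableD.
have n0 A : 0 <= fine (mu A) by rewrite fine_ge0.
exists (NngNum (n0 [set z0])), (NngNum (n0 ([set z1] `\` [set z0]))) => A mA.
rewrite two_diracE/=.
have E B : measurable B -> mu B = (fine (mu B))%:E.
  by move=> mB; rewrite fineK// fin_num_measure.
have mZ : measurable [set z0; z1] by exact: measurableU.
have -> : mu A = mu (A `&` [set z0; z1]).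
  transitivity (mu (A `\` [set z0; z1]) + mu (A `&` [set z0; z1]))%E.
    exact: measureDI.
  suff -> : mu (A `\` [set z0; z1]) = 0%E by rewrite add0e.
  apply: (subset_measure0 _ _ _ h); [exact: measurableD|exact: measurableC|].
  by move=> x [].
have -> : A `&` [set z0; z1] = (A `&` [set z0]) `|` (A `&` ([set z1] `\` [set z0])).
  apply/seteqP; split => x /=.
    move=> [Ax hx]; have [xz|xz] := pselect (x = z0); first by left.
    by right; split => //; split => //; case: hx.
  by move=> [[Ax xz]|[Ax [xz _]]]; split => //; [left|right].
rewrite measureU; [|exact: measurableI|exact: measurableI|]; last first.
  by apply/seteqP; split => // x [[_ xz] [_ [_ xnz]]]; exfalso; exact: xnz.
rewrite EFinD; congr (_ + _)%E.
  have [Az|Az] := boolP (z0 \in A).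
    by rewrite mulr1 -E//; congr (mu _); apply/setIidr => _ ->; exact/set_mem.
  rewrite mulr0 (_ : _ `&` _ = set0) ?measure0//.
  by apply/seteqP; split => // x [Ax xz]; exfalso; move/negP: Az; apply; apply/mem_set; rewrite -xz.
have [Az|Az] := boolP (z1 \in A).
  by rewrite mulr1 -E//; congr (mu _); apply/setIidr => _ [-> _]; exact/set_mem.
rewrite mulr0 (_ : _ `&` _ = set0) ?measure0//.
by apply/seteqP; split => // x [Ax [xz _]]; exfalso; move/negP: Az; apply; apply/mem_set; rewrite -xz.
Qed.

Lemma qform_support mu k a b y0 y1 A : (forall x, 0 <= qform k a b y0 y1 x) ->
  \int[mu]_x qform k a b y0 y1 x = 0 -> measurable A ->
  (forall x, A x -> qform k a b y0 y1 x != 0) -> mu A = 0%E.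
Proof.
move=> f0 /integral_qform_eq0 h mA hA.
have : ae_eq mu setT (fun x => (qform k a b y0 y1 x)%:E) (cst 0%E).
  apply/ae_eq_integral_abs => //.
    by apply/measurable_EFinP; exact: (continuous_measurable_body (@continuous_qform k a b y0 y1)).
  by rewrite -h; apply: eq_integral => x _; rewrite gee0_abs// lee_fin.
move=> [N [mN N0 hN]]; apply: (subset_measure0 mA mN _ N0) => x Ax.
by apply: hN => /= /(_ I)[/eqP]; apply/negP; exact: hA.
Qed.

Lemma HK_dirac_ge mu nu (a h : R) y : 0 <= a -> 0 <= h ->
  (forall A, measurable A -> mu A = (a * (y \in A)%:R)%:E) -> HK mu nu = h%:E ->
  a + mass nu - 2 * Num.sqrt a * Num.sqrt (tcos_mass y nu) <= h ^+ 2.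
Proof.
move=> a0 h0 hmu hk.
pose mu' := two_dirac (NngNum a0) (NngNum (lexx 0)) y y.
have hmu' A : measurable A -> mu A = mu' A.
  by move=> mA; rewrite hmu// two_diracE/= mul0r addr0.
have ma : mass mu = a by rewrite (mass_eq hmu') mass_two_dirac/= addr0.
have ta : tcos_mass y mu = a.
  by rewrite (tcos_mass_eq _ hmu') tcos_mass_two_dirac/= bdistxx tcos0 expr1n mul0r addr0 mulr1.
suff : a + mass nu - h ^+ 2 <= 2 * Num.sqrt a * Num.sqrt (tcos_mass y nu) by lra.
apply: ler_amgm_inf => [||k k0]; rewrite ?sqrtr_ge0// !sqr_sqrtr ?tcos_mass_ge0//.
(* Potentials: the constant k, and [c_y ^ 2] / k. The penalty for [mu] is 1 - [c_y ^ 2], whose only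
   zero is [y]; [nu] gets none. *)
have := @HK_qform_dual mu nu k 0 0 0 k^-1 0 1 (-1) 0 0 0 0 h y y y y y y y y hk h0; cbv zeta.
rewrite !Rintegral_qform ma ta !(mul0r, mul1r, addr0, add0r, mulN1r).
rewrite [_^-1 * _]mulrC => H.
suff : a + mass nu - k * a - tcos_mass y nu / k <= h ^+ 2 by lra.
apply: H; rewrite /qform => //.
- by move=> x; rewrite !(mul0r, addr0) ltW.
- by move=> x; rewrite !(mul0r, addr0, add0r) mulr_ge0 ?sqr_ge0// invr_ge0 ltW.
- move=> x; rewrite mul0r addr0 mulN1r subr_ge0.
  by have /andP[] := tcos2_itv x y.
- by move=> x; rewrite !(mul0r, addr0).
- by rewrite subrr.
- move=> x z r s r0 s0; rewrite !(mul0r, addr0, add0r, mulN1r) => /subr0_eq/esym hx _.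
  have xy : x = y by apply: bdist0_eq; apply: tcos_eq1 => //; exact: bdist_ge0.
  rewrite xy (le_trans (ler_wpM2l _ (cos_pi_le_tcos (bdist_ge0 _ _))))//.
    by rewrite !mulr_ge0.
  apply: two_mul_le; rewrite // ?(ltW k0)//.
  + by rewrite mulrA divff ?gt_eqF// mul1r bdistC.
  + by rewrite mulr_ge0 ?sqr_ge0// invr_ge0 ltW.
Qed.

(** The square roots [P], [Q] of [C_0], [C_1] act as planar coordinates, and [HK] dominates the
    Euclidean distance between them. The mass condition puts both measures on the zero set of 1 -
    [c_0 ^ 2] - [c_1 ^ 2], where [c_0] and [c_1] are the cosine and the sine of one angle. *)
Lemma HK_profile_ge mu nu (P Q P' Q' : R) y0 y1 : pi / 2 <= bdist y0 y1 ->
  0 <= P -> 0 <= Q -> 0 <= P' -> 0 <= Q' ->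
  tcos_mass y0 mu = P ^+ 2 -> tcos_mass y1 mu = Q ^+ 2 -> mass mu = P ^+ 2 + Q ^+ 2 ->
  tcos_mass y0 nu = P' ^+ 2 -> tcos_mass y1 nu = Q' ^+ 2 -> mass nu = P' ^+ 2 + Q' ^+ 2 ->
  ((Num.sqrt ((P - P') ^+ 2 + (Q - Q') ^+ 2))%:E <= HK mu nu)%E.
Proof.
move=> hL P0 Q0 P0' Q0' mP mQ mM nP nQ nM.
have := HK_ge0 mu nu; case hk : (HK mu nu) => [h| |]//; last by move=> _; rewrite leey.
rewrite !lee_fin => h0.
suff hh : (P - P') ^+ 2 + (Q - Q') ^+ 2 <= h ^+ 2.
  by rewrite -[leRHS](ger0_norm h0) -sqrtr_sqr ler_wsqrtr.
suff : P ^+ 2 + Q ^+ 2 + (P' ^+ 2 + Q' ^+ 2) - h ^+ 2 - 2 * Q * Q' <= 2 * P * P'.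
  by rewrite !sqrrB; lra.
apply: ler_amgm_inf => // A A0.
suff : P ^+ 2 + Q ^+ 2 + (P' ^+ 2 + Q' ^+ 2) - h ^+ 2 - (A * P ^+ 2 + P' ^+ 2 / A) <= 2 * Q * Q'.
  by lra.
apply: ler_amgm_inf => // B B0.
have Ai : 0 <= A^-1 by rewrite invr_ge0 ltW.
have Bi : 0 <= B^-1 by rewrite invr_ge0 ltW.
(* The two coordinates are weighted independently, by A and B in the first potential and by their
   inverses in the second. *)
have := @HK_qform_dual mu nu 0 A B 0 A^-1 B^-1 1 (-1) (-1) 1 (-1) (-1) h y0 y1 y0 y1 y0 y1 y0 y1 hk h0; cbv zeta.
rewrite !Rintegral_qform mP mQ mM nP nQ nM !(mul0r, mul1r, add0r, mulN1r).
rewrite ![_^-1 * _]mulrC => H.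
suff : P ^+ 2 + Q ^+ 2 + (P' ^+ 2 + Q' ^+ 2) - (A * P ^+ 2 + B * Q ^+ 2) -
    (P' ^+ 2 / A + Q' ^+ 2 / B) <= h ^+ 2 by lra.
(* The case p = q = 1 of the angle gap, with [tcos] of the distance equal to 0. *)
have gap x : 0 <= 1 - tcos (bdist x y0) ^+ 2 - tcos (bdist x y1) ^+ 2.
  have := @angle_gap_ge0 R (bdist x y0) (bdist x y1) (bdist y0 y1) 1 1.
  rewrite (tcos_eq0 hL) /angle_gap !(mulr0, addr0, mulr1, mul1r); apply; rewrite ?bdist_ge0//.
  by rewrite (bdistC x y0) bdist_triangle.
apply: H; rewrite /qform.
- by move=> x; rewrite add0r addr_ge0// mulr_ge0 ?sqr_ge0// ltW.
- by move=> x; rewrite add0r addr_ge0// mulr_ge0 ?sqr_ge0.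
- by move=> x; rewrite !mulN1r.
- by move=> x; rewrite !mulN1r.
- lra.
- lra.
(* On this set [c_0 c_0' + c_1 c_1'] is the cosine of a difference of truncated angles, which
   dominates [cos_pi] of the distance; each product is then split by its own weight. *)
- have zero x : 1 + -1 * tcos (bdist x y0) ^+ 2 + -1 * tcos (bdist x y1) ^+ 2 = 0 ->
      tsin (bdist x y0) = tcos (bdist x y1).
    move=> hx; apply: (@pexpIrn R 2); rewrite ?nnegrE ?tsin_ge0 ?tcos_ge0 ?bdist_ge0//.
    have := tcos2D_tsin2 (bdist x y0); lra.
  move=> x z r s r0 s0 /zero hx /zero hz; rewrite !add0r.
  have : cos_pi (bdist x z) <= tcos (bdist x y0) * tcos (bdist z y0) +
      tcos (bdist x y1) * tcos (bdist z y1).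
    rewrite -hx -hz; apply: cos_pi_le_tcosB; rewrite ?bdist_ge0//.
    have h1 := bdist_triangle x z y0; have h2 := bdist_triangle z x y0.
    by rewrite (bdistC z x) in h2; rewrite ler_norml; apply/andP; split; lra.
  have rs : 0 <= 2 * r * s by rewrite !mulr_ge0.
  move=> /(ler_wpM2l rs)/le_trans; apply.
  have aux (D u v : R) : 0 < D -> 2 * r * s * (u * v) <= D * u ^+ 2 * r ^+ 2 + D^-1 * v ^+ 2 * s ^+ 2.
    move=> D0; apply: two_mul_le => //.
    + rewrite exprMn (_ : D * _ * _ = D * D^-1 * (u ^+ 2 * v ^+ 2)); last by ring.
      by rewrite divff ?gt_eqF// mul1r.
    + by rewrite mulr_ge0 ?sqr_ge0// ltW.
    + by rewrite mulr_ge0 ?sqr_ge0// invr_ge0 ltW.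
  have h1 := aux A (tcos (bdist x y0)) (tcos (bdist z y0)) A0.
  have h2 := aux B (tcos (bdist x y1)) (tcos (bdist z y1)) B0.
  lra.
Qed.

End lower_bounds.

(** * Uniqueness of geodesics *)

Section geodesic_algebra.
Context {R : realType}.

(** [S0], [S1] stand for the square roots of [C_0], [C_1], [m] for the mass and [D2] for the squared
    speed. Weights 1 - t and t on the endpoint inequalities leave t (1 - t) D2 on the right. After
    multiplying by [u * v] and completing squares, three nonnegative terms have a nonpositive sum,
    so each is 0. *)
Lemma geodesic_algebra (r0 r1 t c D2 S0 S1 m : R) : 0 < r0 -> 0 < r1 ->
  0 < t < 1 -> 0 <= c ->
  let p := (1 - t) * r0 in let q := t * r1 in
  let u := p + q * c in let v := q + p * c in
  D2 <= r0 ^+ 2 + r1 ^+ 2 - 2 * r0 * r1 * c ->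
  r0 ^+ 2 + m - 2 * r0 * S0 <= t ^+ 2 * D2 ->
  r1 ^+ 2 + m - 2 * r1 * S1 <= (1 - t) ^+ 2 * D2 ->
  0 <= u * v * m - p * v * S0 ^+ 2 - q * u * S1 ^+ 2 ->
  [/\ S0 = u, S1 = v & u * v * m - p * v * S0 ^+ 2 - q * u * S1 ^+ 2 = 0].
Proof.
move=> r00 r10 /andP[t0 t1] c0 p q u v hD h0 h1 hgap.
have s0 : 0 < 1 - t by rewrite subr_gt0.
have p0 : 0 < p by rewrite mulr_gt0.
have q0 : 0 < q by rewrite mulr_gt0.
have u0 : 0 < u by rewrite ltr_pwDl// mulr_ge0// ltW.
have v0 : 0 < v by rewrite ltr_pwDl// mulr_ge0// ltW.
have hD' := ler_wpM2l (ltW (mulr_gt0 t0 s0)) hD.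
have h0' := ler_wpM2l (ltW s0) h0; have h1' := ler_wpM2l (ltW t0) h1.
have hm : m - 2 * p * S0 - 2 * q * S1 + (p * u + q * v) <= 0.
  have -> : m - 2 * p * S0 - 2 * q * S1 + (p * u + q * v) =
    (1 - t) * (r0 ^+ 2 + m - 2 * r0 * S0) + t * (r1 ^+ 2 + m - 2 * r1 * S1)
    - t * (1 - t) * (r0 ^+ 2 + r1 ^+ 2 - 2 * r0 * r1 * c).
    by rewrite /u /v /p /q; ring.
  have E : (1 - t) * (t ^+ 2 * D2) + t * ((1 - t) ^+ 2 * D2) = t * (1 - t) * D2 by ring.
  lra.
have hm' := ler_wpM2l (ltW (mulr_gt0 u0 v0)) hm.
have E : u * v * (m - 2 * p * S0 - 2 * q * S1 + (p * u + q * v)) =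
  p * v * (S0 - u) ^+ 2 + q * u * (S1 - v) ^+ 2 +
  (u * v * m - p * v * S0 ^+ 2 - q * u * S1 ^+ 2) by ring.
have pv := mulr_gt0 p0 v0; have qu := mulr_gt0 q0 u0.
have i0 : 0 <= p * v * (S0 - u) ^+ 2 by rewrite mulr_ge0 ?sqr_ge0// ltW.
have i1 : 0 <= q * u * (S1 - v) ^+ 2 by rewrite mulr_ge0 ?sqr_ge0// ltW.
rewrite mulr0 E in hm'.
have e0 : p * v * (S0 - u) ^+ 2 = 0 by lra.
have e1 : q * u * (S1 - v) ^+ 2 = 0 by lra.
split; last lra.
- apply/eqP; rewrite -subr_eq0 -sqrf_eq0; move/eqP: e0.
  by rewrite mulf_eq0 (gt_eqF pv).
- apply/eqP; rewrite -subr_eq0 -sqrf_eq0; move/eqP: e1.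
  by rewrite mulf_eq0 (gt_eqF qu).
Qed.

End geodesic_algebra.

Definition i01_0 {R : realType} : {i01 R} := 0%:i01.
Definition i01_1 {R : realType} : {i01 R} := 1%:i01.

Section signed_lemmas.
Context {disp : measure_display} {T : measurableType disp} {R : realType}.
Implicit Types mu nu : {finite_measure set T -> \bar R}.

Lemma signed_eqP mu nu : signed mu = signed nu <-> (forall A, measurable A -> mu A = nu A).
Proof.
split => [h A mA|h].
  have := congr1 (fun w : signed_measure T R => (w : set T -> R) A) h.
  rewrite /= /signed_fun asboolT// => hA.
  by rewrite -[LHS]fineK ?fin_num_measure// -[RHS]fineK ?fin_num_measure// hA.
apply: val_inj => /=; apply/funext => A; rewrite /signed_fun.
by case: asboolP => // mA; rewrite h.
Qed.

End signed_lemmas.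

Section uniqueness.
Context {R : realType} {d : nat} {Omega : set 'rV[R]_d} {x0 : Omega}.
Local Notation X := (body x0).
Local Notation fm T := {finite_measure set T -> \bar R}.
Variables (y0 y1 : X) (a0 a1 : {posnum R}).
Local Notation L := (bdist y0 y1).
Local Notation r0 := (Num.sqrt a0%:num).
Local Notation r1 := (Num.sqrt a1%:num).
Local Notation K := (a0%:num + a1%:num - 2 * r0 * r1 * tcos L).

Let r0_gt0 : 0 < r0. Proof. by rewrite sqrtr_gt0. Qed.
Let r1_gt0 : 0 < r1. Proof. by rewrite sqrtr_gt0. Qed.
Let r0E : r0 ^+ 2 = a0%:num. Proof. by rewrite sqr_sqrtr. Qed.
Let r1E : r1 ^+ 2 = a1%:num. Proof. by rewrite sqr_sqrtr. Qed.

Lemma point_massE (a : {posnum R}) (y : X) A : point_mass a y A = (a%:num * (y \in A)%:R)%:E.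
Proof.
change (a%:num%:E * (\1_A y)%:E = (a%:num * (y \in A)%:R)%:E)%E.
by rewrite indicE -EFinM.
Qed.

Definition dirac_pair (s0 s1 : {nonneg R}) (z0 z1 : X) : fm X :=
  two_dirac (s0%:num ^+ 2)%:nng (s1%:num ^+ 2)%:nng z0 z1.

Lemma dirac_pairE s0 s1 z0 z1 A : dirac_pair s0 s1 z0 z1 A =
  (s0%:num ^+ 2 * (z0 \in A)%:R + s1%:num ^+ 2 * (z1 \in A)%:R)%:E.
Proof. by rewrite two_diracE. Qed.

Lemma HK2_le_dirac_pair (s0 s1 t0 t1 : {nonneg R}) (z0 z1 w0 w1 : X) :
  HK2_le (dirac_pair s0 s1 z0 z1) (dirac_pair t0 t1 w0 w1)
    ((s0%:num ^+ 2 + t0%:num ^+ 2 - 2 * s0%:num * t0%:num * cos_pi (bdist z0 w0)) +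
     (s1%:num ^+ 2 + t1%:num ^+ 2 - 2 * s1%:num * t1%:num * cos_pi (bdist z1 w1))).
Proof. by apply: HK2_le_add; exact: HK2_le_dirac. Qed.

(** Up to distance pi/2 the atom is moved; beyond, it is sent to the vertex while the other grows
    out of the vertex. This is where the truncated cosine arises. Atoms of weight 0 give both plans
    the same shape. *)
Lemma HK2_le_point_mass : HK2_le (point_mass a0 y0) (point_mass a1 y1) K.
Proof.
pose z : {nonneg R} := NngNum (lexx 0).
pose s0 : {nonneg R} := NngNum (ltW r0_gt0).
pose s1 : {nonneg R} := NngNum (ltW r1_gt0).
have [hL|hL] := leP L (pi / 2).
  apply: (@HK2_le_eq _ _ _ _ (dirac_pair s0 z y0 y0) _ (dirac_pair s1 z y1 y1)).
  - by move=> A mA; rewrite dirac_pairE point_massE/= r0E expr0n/= mul0r addr0.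
  - by move=> A mA; rewrite dirac_pairE point_massE/= r1E expr0n/= mul0r addr0.
  have := HK2_le_dirac_pair s0 z s1 z y0 y0 y1 y1.
  by rewrite /= expr0n/= !(mulr0, mul0r, addr0, subr0) r0E r1E cos_piE// tcosE.
apply: (@HK2_le_eq _ _ _ _ (dirac_pair s0 z y0 y1) _ (dirac_pair z s1 y0 y1)).
- by move=> A mA; rewrite dirac_pairE point_massE/= r0E expr0n/= mul0r addr0.
- by move=> A mA; rewrite dirac_pairE point_massE/= r1E expr0n/= mul0r add0r.
have := HK2_le_dirac_pair s0 z z s1 y0 y1 y0 y1.
by rewrite /= expr0n/= !(mulr0, mul0r, addr0, subr0, add0r) r0E r1E tcos_eq0 ?(ltW hL)// mulr0 subr0.
Qed.

Lemma hk2_point_mass_ge0 : 0 <= K.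
Proof.
have := sqr_ge0 (r0 - r1); rewrite sqrrB r0E r1E.
have : 0 <= 2 * r0 * r1 * (1 - tcos L).
  apply: mulr_ge0; last by rewrite subr_ge0 tcos_le1.
  by apply: mulr_ge0; [apply: mulr_ge0 => //; exact: ltW|exact: ltW].
lra.
Qed.

Definition is_geodesic_between (c : {i01 R} -> fm X) : Prop :=
  [/\ geodesic c, forall A, measurable A -> c i01_0 A = point_mass a0 y0 A
    & forall A, measurable A -> c i01_1 A = point_mass a1 y1 A].

(** [D] is the distance of the endpoints, finite thanks to the explicit plan. The upper bound on it
    is all that the tightness argument uses. *)
Lemma geodesic_speed c : is_geodesic_between c ->
  exists D, [/\ 0 <= D, D ^+ 2 <= K &
    forall s t : {i01 R}, HK (c s) (c t) = (`|s%:num - t%:num| * D)%:E].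
Proof.
move=> [gc c0 c1].
have hK : (HK (c i01_0) (c i01_1) <= (Num.sqrt K)%:E)%E.
  apply/HK2_leP; first exact: hk2_point_mass_ge0.
  by apply: HK2_le_eq HK2_le_point_mass => A mA; rewrite ?c0 ?c1.
have := HK_ge0 (c i01_0) (c i01_1).
case hD : (HK (c i01_0) (c i01_1)) hK => [D| |]//.
rewrite !lee_fin => DK D0; exists D; split => //.
  by rewrite -[leRHS]sqr_sqrtr ?hk2_point_mass_ge0// ler_pXn2r ?nnegrE// sqrtr_ge0.
by move=> s t; rewrite EFinM -hD; exact: gc.
Qed.

Section interior.
Variables (c : {i01 R} -> fm X) (t : {i01 R}).
Hypothesis gc : is_geodesic_between c.
Hypothesis t01 : 0 < t%:num < 1.
Local Notation p := ((1 - t%:num) * r0).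
Local Notation q := (t%:num * r1).
Local Notation u := (p + q * tcos L).
Local Notation v := (q + p * tcos L).
Local Notation gap := (qform (u * v) (- (p * v)) (- (q * u)) y0 y1).

Lemma geodesic_gapE x : gap x = angle_gap p q (tcos L) (tcos (bdist x y0)) (tcos (bdist x y1)).
Proof. by rewrite /qform /angle_gap; ring. Qed.

Let p0 : 0 < p. Proof. by move/andP: t01 => [? ?]; rewrite mulr_gt0// subr_gt0. Qed.
Let q0 : 0 < q. Proof. by move/andP: t01 => [? ?]; rewrite mulr_gt0. Qed.

Lemma geodesic_gap_ge0 x : 0 <= gap x.
Proof.
rewrite geodesic_gapE; apply: angle_gap_ge0; rewrite ?bdist_ge0 ?(ltW p0) ?(ltW q0)//.
by rewrite (bdistC x y0) bdist_triangle.
Qed.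

Lemma geodesic_point : [/\ tcos_mass y0 (c t) = u ^+ 2, tcos_mass y1 (c t) = v ^+ 2
  & \int[c t]_x gap x = 0].
Proof.
have [D [D0 DK HKD]] := geodesic_speed gc; have [_ c0 c1] := gc.
have /andP[t0 t1] := t01.
have a00 : 0 <= a0%:num by []. have a10 : 0 <= a1%:num by [].
have h0 := HKD i01_0 t; have h1 := HKD i01_1 t.
have g0 : 0 <= `|(0 : R) - t%:num| * D by rewrite mulr_ge0.
have g1 : 0 <= `|(1 : R) - t%:num| * D by rewrite mulr_ge0.
have E0 := @HK_dirac_ge _ _ _ _ (c i01_0) (c t) a0%:num _ y0 a00 g0.
have E1 := @HK_dirac_ge _ _ _ _ (c i01_1) (c t) a1%:num _ y1 a10 g1.
have {}E0 := E0 (fun A mA => etrans (c0 A mA) (point_massE _ _ _)) h0.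
have {}E1 := E1 (fun A mA => etrans (c1 A mA) (point_massE _ _ _)) h1.
move: E0 E1; rewrite !exprMn !real_normK ?num_real// sub0r sqrrN => E0 E1.
have gI : 0 <= \int[c t]_x gap x by apply: Rintegral_ge0 => x _; exact: geodesic_gap_ge0.
move: (gI); rewrite Rintegral_qform.
rewrite -(sqr_sqrtr (tcos_mass_ge0 y0 (c t))) -(sqr_sqrtr (tcos_mass_ge0 y1 (c t))) !mulNr => gI'.
have := @geodesic_algebra _ r0 r1 t%:num (tcos L) (D ^+ 2) (Num.sqrt (tcos_mass y0 (c t)))
  (Num.sqrt (tcos_mass y1 (c t))) (mass (c t)) r0_gt0 r1_gt0 t01 (tcos_ge0 (bdist_ge0 _ _)).
cbv zeta; rewrite r0E r1E => /(_ DK E0 E1 gI')[S0 S1 S2].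
by rewrite S0 S1 in S2 *; split => //; rewrite S2.
Qed.

Lemma geodesic_gap_support A : measurable A -> (forall x, A x -> gap x != 0) -> c t A = 0%E.
Proof.
have [_ _ h] := geodesic_point; move=> mA hA; exact: (qform_support geodesic_gap_ge0 h mA hA).
Qed.

Lemma mean_radius_gt0 : 0 < u.
Proof. by rewrite ltr_pwDl// mulr_ge0 ?(ltW q0)// tcos_ge0// bdist_ge0. Qed.

(** Without zeros the measure at time [t] would be null, against [C_0 = u ^ 2 > 0]. So the zero need
    not be constructed. *)
Lemma geodesic_gap_zero : exists z, gap z = 0.
Proof.
apply: contrapT => h.
have c0 : c t setT = 0%E.
  by apply: geodesic_gap_support => // x _; apply/eqP => hx; apply: h; exists x.
have [h0 _ _] := geodesic_point.
have : tcos_mass y0 (c t) <= mass (c t).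
  rewrite -[leRHS]mul1r -Rintegral_cst//; apply: le_Rintegral => //.
  - exact: tcos2_integrable.
  - exact: finite_measure_integrable_cst.
  - by move=> x _; have /andP[] := tcos2_itv x y0.
rewrite h0 /mass c0/= => h1; have := exprn_gt0 2 mean_radius_gt0; lra.
Qed.

Lemma geodesic_gap_zero_uniq x z : L < pi / 2 -> gap x = 0 -> gap z = 0 -> x = z.
Proof.
move=> L2; rewrite !geodesic_gapE.
have L0 : 0 <= L < pi / 2 by rewrite bdist_ge0.
have tri w : L <= bdist w y0 + bdist w y1 by rewrite (bdistC w y0) bdist_triangle.
move=> /(angle_gap_eq0 (bdist_ge0 _ _) (bdist_ge0 _ _) L0 (tri x) p0 q0)[hx sx].
move=> /(angle_gap_eq0 (bdist_ge0 _ _) (bdist_ge0 _ _) L0 (tri z) p0 q0)[hz sz].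
(* Zeros lie on the segment. At distance a from [y0] the balance reads p sin a = q sin (L - a); the
   left side increases in a and the right side decreases. *)
have aux w w' : L = bdist w y0 + bdist w y1 -> L = bdist w' y0 + bdist w' y1 ->
   p * sin (bdist w y0) = q * sin (bdist w y1) ->
   p * sin (bdist w' y0) = q * sin (bdist w' y1) -> bdist w' y0 <= bdist w y0.
  move=> hw hw' sw sw'; rewrite leNgt; apply/negP => lt.
  have := bdist_ge0 w y0; have := bdist_ge0 w' y0.
  have := bdist_ge0 w y1; have := bdist_ge0 w' y1 => g1 g2 g3 g4.
  have p2 := pi_gt0 R.
  have i1 : sin (bdist w y0) < sin (bdist w' y0).
    by rewrite ltr_sin ?in_itv//=; apply/andP; split; lra.
  have i2 : sin (bdist w' y1) < sin (bdist w y1).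
    by rewrite ltr_sin ?in_itv/=; [lra|apply/andP; split; lra|apply/andP; split; lra].
  have := ltr_pM2l p0 (sin (bdist w y0)) (sin (bdist w' y0)); rewrite i1 sw sw'.
  by rewrite ltr_pM2l// => /lt_trans/(_ i2); rewrite ltxx.
have xz : bdist x y0 = bdist z y0 by apply/le_anti; rewrite !aux.
have [L00|L0n] := eqVneq L 0.
  have := bdist_ge0 x y0; have := bdist_ge0 x y1 => ? ?.
  have x00 : bdist x y0 = 0 by lra.
  by rewrite (bdist0_eq x00) (bdist0_eq (etrans (esym xz) x00)).
have Lp : 0 < L by rewrite lt_neqAle eq_sym L0n bdist_ge0.
apply: val_inj.
rewrite (bdistC x) in hx; rewrite (bdistC z) in hz; rewrite (bdistC x) (bdistC z) in xz.
rewrite [LHS](euclid_dist_between Lp hx) [RHS](euclid_dist_between Lp hz).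
by rewrite -!/(bdist _ _) xz.
Qed.

End interior.

Lemma geodesic_unique c c' (t : {i01 R}) : L <> pi / 2 ->
  is_geodesic_between c -> is_geodesic_between c' ->
  forall A, measurable A -> c t A = c' t A.
Proof.
move=> hL gc gc' A mA.
have [t0|t0] := eqVneq t%:num 0.
  have -> : t = i01_0 by apply: val_inj.
  by case: gc gc' => _ -> // _ [_ -> //].
have [t1|t1] := eqVneq t%:num 1.
  have -> : t = i01_1 by apply: val_inj.
  by case: gc gc' => _ _ -> // [_ _ -> //].
have t01 : 0 < t%:num < 1.
  by rewrite lt_neqAle eq_sym t0 lt_neqAle t1/= ge0 le1.
have [h0 h1 _] := geodesic_point gc t01; have [h0' h1' _] := geodesic_point gc' t01.
have u0 := mean_radius_gt0 t01.
have mC z0 z1 : measurable (~` [set z0; z1] : set X).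
  by apply: measurableC; apply: measurableU; exact: measurable_singleton.
have [L2|L2|//] := ltgtP L (pi / 2).
  have [z hz] := geodesic_gap_zero gc t01.
  have nz x : (~` [set z; z]) x -> qform (((1 - t%:num) * r0 + t%:num * r1 * tcos L) *
     (t%:num * r1 + (1 - t%:num) * r0 * tcos L))
     (- ((1 - t%:num) * r0 * (t%:num * r1 + (1 - t%:num) * r0 * tcos L)))
     (- (t%:num * r1 * ((1 - t%:num) * r0 + t%:num * r1 * tcos L))) y0 y1 x != 0.
    by move=> hx; apply/eqP => hx0; apply: hx; left; exact: (geodesic_gap_zero_uniq t01 L2).
  have [w0 [w1 cE]] := two_dirac_measure (geodesic_gap_support gc t01 (mC z z) nz).
  have [w0' [w1' cE']] := two_dirac_measure (geodesic_gap_support gc' t01 (mC z z) nz).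
  rewrite cE// cE'// !two_diracE -!mulrDl.
  rewrite (tcos_mass_eq _ cE) tcos_mass_two_dirac -mulrDl in h0.
  rewrite (tcos_mass_eq _ cE') tcos_mass_two_dirac -mulrDl -h0 in h0'.
  (* Both total weights, multiplied by [c_0 ^ 2] at [z], give [u ^ 2 > 0]; the common factor is
     therefore nonzero and cancels. *)
  congr (_ * _)%:E; apply/esym/(mulIf _ h0').
  apply/eqP => hzz; move: h0; rewrite hzz mulr0 => /esym/eqP.
  by rewrite sqrf_eq0 (gt_eqF u0).
have nz x : (~` [set y0; y1]) x -> qform (((1 - t%:num) * r0 + t%:num * r1 * tcos L) *
     (t%:num * r1 + (1 - t%:num) * r0 * tcos L))
     (- ((1 - t%:num) * r0 * (t%:num * r1 + (1 - t%:num) * r0 * tcos L)))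
     (- (t%:num * r1 * ((1 - t%:num) * r0 + t%:num * r1 * tcos L))) y0 y1 x != 0.
  move=> hx; apply/eqP; rewrite geodesic_gapE => hx0; apply: hx.
  have /andP[t0' t1'] := t01.
  have p0 : 0 < (1 - t%:num) * r0 by rewrite mulr_gt0// subr_gt0.
  have q0 : 0 < t%:num * r1 by rewrite mulr_gt0.
  have tri : L <= bdist x y0 + bdist x y1 by rewrite (bdistC x y0) bdist_triangle.
  have [/bdist0_eq|/bdist0_eq] := angle_gap_eq0_ge (bdist_ge0 x y0) (bdist_ge0 x y1) L2 tri p0 q0 hx0.
    by left.
  by right.
have [w0 [w1 cE]] := two_dirac_measure (geodesic_gap_support gc t01 (mC y0 y1) nz).
have [w0' [w1' cE']] := two_dirac_measure (geodesic_gap_support gc' t01 (mC y0 y1) nz).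
rewrite (tcos_mass_eq _ cE) tcos_mass_two_dirac in h0.
rewrite (tcos_mass_eq _ cE) tcos_mass_two_dirac in h1.
rewrite (tcos_mass_eq _ cE') tcos_mass_two_dirac -h0 in h0'.
rewrite (tcos_mass_eq _ cE') tcos_mass_two_dirac -h1 in h1'.
(* Beyond pi/2 each of [C_0], [C_1] sees only the atom at its own point, so they read off the two
   weights. *)
move: h0' h1'; rewrite !bdistxx tcos0 (bdistC y1) (tcos_eq0 (ltW L2)) expr1n expr0n/=.
rewrite !(mulr0, mulr1, addr0, add0r) => w00 w11.
by rewrite cE// cE'// !two_diracE w00 w11.
Qed.

End uniqueness.

(** * Construction of geodesics *)

Section existence.
Context {R : realType} {d : nat} {Omega : set 'rV[R]_d} {x0 : Omega}.
Local Notation X := (body x0).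
Local Notation fm T := {finite_measure set T -> \bar R}.
Hypothesis Omega_convex : convex_set Omega.
Variables (y0 y1 : X).
Local Notation L := (bdist y0 y1).

(** Arc-length parametrization of the segment; convexity of [Omega] keeps it inside. For [L = 0] the
    quotient [a / L] is 0 and the constant curve results. *)
Lemma segment_arc : exists z : R -> X, [/\ z 0 = y0, z L = y1
  & forall a b, 0 <= a <= L -> 0 <= b <= L -> bdist (z a) (z b) = `|a - b|].
Proof.
have [z hz] : {z : R -> X & forall a, 0 <= a <= L ->
    val (z a) = val y0 + (a / L) *: (val y1 - val y0)}.
  apply: (@choice _ _ (fun a z => 0 <= a <= L -> val z = val y0 + (a / L) *: (val y1 - val y0))) => a.
  have [/andP[a0 aL]|na] := boolP (0 <= a <= L); last by exists y0.
  have k0 : 0 <= a / L by rewrite divr_ge0 ?bdist_ge0.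
  have k1 : a / L <= 1.
    have := bdist_ge0 y0 y1; rewrite le_eqVlt => /orP[/eqP<-|Lp]; first by rewrite invr0 mulr0.
    by rewrite ler_pdivrMr// mul1r.
  have m1 : (val y1 : convex_lmodType 'rV[R]_d) \in Omega by exact: (valP y1).
  have m0 : (val y0 : convex_lmodType 'rV[R]_d) \in Omega by exact: (valP y0).
  have hm := Omega_convex (Itv01 k0 k1) m1 m0.
  exists (exist (fun v : 'rV[R]_d => v \in Omega) _ hm) => _ /=.
  change ((a / L) *: val y1 + (1 - a / L) *: val y0 = val y0 + (a / L) *: (val y1 - val y0)).
  by rewrite scalerBl scale1r scalerBr addrCA.
have L0 := bdist_ge0 y0 y1.
exists z; split.
- by apply: val_inj; rewrite hz ?lexx ?bdist_ge0// mul0r scale0r addr0.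
- apply: val_inj; rewrite hz ?lexx ?L0//.
  have [LE|Ln] := eqVneq L 0; last by rewrite divff// scale1r addrC subrK.
  by rewrite LE mul0r scale0r addr0 (bdist0_eq LE).
- move=> a b ha hb; rewrite /bdist hz// hz// euclid_dist_line -/(bdist y0 y1).
  have [LE|Ln] := eqVneq L 0.
    move: ha hb; rewrite LE => /andP[? ?] /andP[? ?].
    have -> : a = 0 by lra. have -> : b = 0 by lra.
    by rewrite !mul0r subrr normr0 mul0r.
  by rewrite -mulrBl normrM -[X in _ * X](ger0_norm L0) -mulrA -normrM mulVf// normr1 mulr1.
Qed.

Lemma geodesic_intro (c : {i01 R} -> fm X) (K : R) : 0 <= K ->
  (forall s t : {i01 R}, HK2_le (c s) (c t) ((s%:num - t%:num) ^+ 2 * K)) ->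
  (forall s t : {i01 R}, ((Num.sqrt ((s%:num - t%:num) ^+ 2 * K))%:E <= HK (c s) (c t))%E) ->
  geodesic c.
Proof.
move=> K0 hu hl.
have E s t : HK (c s) (c t) = (`|s%:num - t%:num| * Num.sqrt K)%:E.
  rewrite -sqrtr_sqr -sqrtrM ?sqr_ge0//; apply/le_anti; rewrite hl andbT.
  by apply/HK2_leP => //; rewrite mulr_ge0 ?sqr_ge0.
by move=> s t; rewrite !E/= sub0r normrN normr1 mul1r -EFinM.
Qed.

Lemma onem_i01_ge0 (t : {i01 R}) (e : R) : 0 <= e -> 0 <= (1 - t%:num) * e.
Proof. by move=> e0; rewrite mulr_ge0// subr_ge0. Qed.

Lemma i01_itv (t : {i01 R}) : 0 <= t%:num <= 1. Proof. by rewrite ge0 le1. Qed.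

Section ray.
Variables (e b0 b1 : R) (z : R -> X).
Hypothesis e0 : 0 <= e.
Hypothesis b0_gt0 : 0 < b0.
Hypothesis b1_gt0 : 0 < b1.
Hypothesis L2 : L <= pi / 2.
Hypothesis z0 : z 0 = y0.
Hypothesis zL : z L = y1.
Hypothesis zdist : forall a b, 0 <= a <= L -> 0 <= b <= L -> bdist (z a) (z b) = `|a - b|.

(* The mass [e ^ 2] left at [y0] decays through the vertex, while [b0 ^ 2] travels
   to [b1 ^ 2] at [y1] along a planar segment. *)
Definition ray (t : {i01 R}) : fm X :=
  dirac_pair (NngNum (onem_i01_ge0 t e0)) (NngNum (planarR_ge0 L b0 b1 t%:num))
    y0 (z (planarA L b0 b1 t%:num)).

Let L02 : 0 <= L <= pi / 2. Proof. by rewrite bdist_ge0. Qed.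
Let bdist_z0 a : 0 <= a <= L -> bdist (z a) y0 = a.
Proof.
move=> ha; have /andP[a0 _] := ha.
by rewrite -[in LHS]z0 zdist ?lexx ?bdist_ge0// subr0 ger0_norm.
Qed.

Let bdist_zL a : 0 <= a <= L -> bdist (z a) y1 = L - a.
Proof.
move=> ha; have := zdist ha (_ : 0 <= L <= L); rewrite zL => -> //.
  by have /andP[_ aL] := ha; rewrite distrC ger0_norm// subr_ge0.
by rewrite bdist_ge0 lexx.
Qed.

Let A_itv (t : {i01 R}) := planarA_itv L02 b0_gt0 b1_gt0 (i01_itv t).

Lemma bdist_ray (s t : {i01 R}) :
  bdist (z (planarA L b0 b1 s%:num)) (z (planarA L b0 b1 t%:num)) =
  `|planarA L b0 b1 s%:num - planarA L b0 b1 t%:num|.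
Proof. by rewrite zdist. Qed.

Lemma ray_upper (s t : {i01 R}) : HK2_le (ray s) (ray t)
  ((s%:num - t%:num) ^+ 2 * (e ^+ 2 + (b0 ^+ 2 + b1 ^+ 2 - 2 * b0 * b1 * cos L))).
Proof.
have := HK2_le_dirac_pair (NngNum (onem_i01_ge0 s e0)) (NngNum (planarR_ge0 L b0 b1 s%:num))
  (NngNum (onem_i01_ge0 t e0)) (NngNum (planarR_ge0 L b0 b1 t%:num))
  y0 (z (planarA L b0 b1 s%:num)) y0 (z (planarA L b0 b1 t%:num)).
rewrite -/(ray s) -/(ray t)/= bdist_ray bdistxx.
have L2' := L2; have /andP[? ?] := A_itv s; have /andP[? ?] := A_itv t.
rewrite !cos_piE ?divr_ge0 ?pi_ge0//; last by rewrite ler_norml; apply/andP; split; lra.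
rewrite cos_norm cos0 planar_dist ?i01_itv//.
by congr HK2_le; ring.
Qed.

Lemma ray0 A : ray i01_0 A = ((e ^+ 2 + b0 ^+ 2) * (y0 \in A)%:R)%:E.
Proof. by rewrite dirac_pairE/= subr0 mul1r planarR0// planarA0// z0 mulrDl. Qed.

Lemma ray1 A : ray i01_1 A = (b1 ^+ 2 * (y1 \in A)%:R)%:E.
Proof.
by rewrite dirac_pairE/= subrr mul0r expr0n/= mul0r add0r planarR1// planarA1// zL.
Qed.

Lemma mass_ray (t : {i01 R}) : mass (ray t) =
  ((1 - t%:num) * e) ^+ 2 + planarR L b0 b1 t%:num ^+ 2.
Proof. by rewrite mass_two_dirac. Qed.

Lemma tcos_mass_ray0 (t : {i01 R}) : tcos_mass y0 (ray t) =
  ((1 - t%:num) * e) ^+ 2 + planarX L b0 b1 t%:num ^+ 2.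
Proof.
rewrite tcos_mass_two_dirac/= bdistxx tcos0 expr1n mulr1; congr (_ + _).
have /andP[A0 AL] := A_itv t.
rewrite bdist_z0 ?A0// tcosE; last exact: le_trans L2.
by rewrite -exprMn planarX_cos// i01_itv.
Qed.

Lemma tcos_mass_ray1 (t : {i01 R}) : L = pi / 2 -> tcos_mass y1 (ray t) =
  planarY L b1 t%:num ^+ 2.
Proof.
move=> LE; have hL : pi / 2 <= L by rewrite LE.
rewrite tcos_mass_two_dirac/= (tcos_eq0 hL).
rewrite expr0n/= mulr0 add0r.
have /andP[A0 AL] := A_itv t.
rewrite bdist_zL ?A0// tcosE; last by have := LE; lra.
rewrite -exprMn -cosN opprB (_ : planarA _ _ _ _ - L = planarA L b0 b1 t%:num - pi / 2).
  by rewrite cosBpihalf planarY_sin// i01_itv.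
by congr (_ - _).
Qed.

(** With [e = 0] the curve is a single moving atom, and the bound from a point mass is already sharp
    between two atoms at distance at most pi/2. *)
Lemma ray_lower_lt (s t : {i01 R}) : e = 0 ->
  ((Num.sqrt ((s%:num - t%:num) ^+ 2 * (b0 ^+ 2 + b1 ^+ 2 - 2 * b0 * b1 * cos L)))%:E
   <= HK (ray s) (ray t))%E.
Proof.
move=> e00; have := HK_ge0 (ray s) (ray t).
case hk : (HK (ray s) (ray t)) => [h| |]//; last by move=> _; rewrite leey.
rewrite !lee_fin => h0.
suff hh : (s%:num - t%:num) ^+ 2 * (b0 ^+ 2 + b1 ^+ 2 - 2 * b0 * b1 * cos L) <= h ^+ 2.
  by rewrite -[leRHS](ger0_norm h0) -sqrtr_sqr ler_wsqrtr.
rewrite -planar_dist ?i01_itv//.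
have hs A : measurable A -> ray s A =
    (planarR L b0 b1 s%:num ^+ 2 * (z (planarA L b0 b1 s%:num) \in A)%:R)%:E.
  by move=> _; rewrite dirac_pairE/= e00 mulr0 expr0n/= mul0r add0r.
have := HK_dirac_ge (sqr_ge0 _) h0 hs hk.
rewrite mass_ray tcos_mass_two_dirac/= e00 mulr0 expr0n/= mul0r !add0r.
have L2' := L2; have /andP[? ?] := A_itv s; have /andP[? ?] := A_itv t.
rewrite bdist_ray tcosE; last by rewrite ler_norml; apply/andP; split; lra.
rewrite cos_norm -exprMn !sqrtr_sqr.
rewrite (ger0_norm (planarR_ge0 _ _ _ _)) ger0_norm; last first.
  by rewrite mulr_ge0 ?planarR_ge0// cos_ge0_pihalf//; apply/andP; split; lra.
rewrite -[planarA _ _ _ t%:num - _]opprB cosN; lra.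
Qed.

(** At the critical distance the planar coordinates are (1 - t) b0 and t b1. The resting atom adds
    to the first one in square, so the square root of [C_0] is (1 - t) [r] with
    [r ^+ 2 = e ^+ 2 + b0 ^+ 2], however the mass is split. *)
Lemma ray_lower_eq (s t : {i01 R}) : L = pi / 2 ->
  ((Num.sqrt ((s%:num - t%:num) ^+ 2 * (e ^+ 2 + b0 ^+ 2 + b1 ^+ 2)))%:E
   <= HK (ray s) (ray t))%E.
Proof.
move=> LE; have w0 : 0 <= e ^+ 2 + b0 ^+ 2 by rewrite addr_ge0 ?sqr_ge0.
pose r := Num.sqrt (e ^+ 2 + b0 ^+ 2).
have r0 : 0 <= r by rewrite sqrtr_ge0.
have rE : r ^+ 2 = e ^+ 2 + b0 ^+ 2 by rewrite sqr_sqrtr.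
have X2 (u : {i01 R}) : planarX L b0 b1 u%:num = (1 - u%:num) * b0.
  by rewrite /planarX LE cos_pihalf mulr0 addr0.
have Y2 (u : {i01 R}) : planarY L b1 u%:num = u%:num * b1.
  by rewrite /planarY LE sin_pihalf mulr1.
have h0 (u : {i01 R}) : tcos_mass y0 (ray u) = ((1 - u%:num) * r) ^+ 2.
  by rewrite tcos_mass_ray0 X2 !exprMn rE mulrDr.
have h1 (u : {i01 R}) : tcos_mass y1 (ray u) = (u%:num * b1) ^+ 2.
  by rewrite tcos_mass_ray1// Y2.
have hm (u : {i01 R}) : mass (ray u) = ((1 - u%:num) * r) ^+ 2 + (u%:num * b1) ^+ 2.
  by rewrite mass_ray planarR2 X2 Y2 !exprMn rE; ring.
have P0 (u : {i01 R}) : 0 <= (1 - u%:num) * r by rewrite mulr_ge0// subr_ge0.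
have Q0 (u : {i01 R}) : 0 <= u%:num * b1 by rewrite mulr_ge0// ltW.
have hL : pi / 2 <= L by rewrite LE.
have := HK_profile_ge hL (P0 s) (Q0 s) (P0 t) (Q0 t) (h0 s) (h1 s) (hm s) (h0 t) (h1 t) (hm t).
by congr (_ <= _)%E; congr (Num.sqrt _)%:E; rewrite -rE; ring.
Qed.

End ray.

Lemma vertex_pair_lower (s t : {i01 R}) (b0 b1 : R) (hb0 : 0 <= b0) (hb1 : 0 <= b1)
    (P : forall u : {i01 R}, 0 <= (1 - u%:num) * b0) (Q : forall u : {i01 R}, 0 <= u%:num * b1) :
  pi / 2 <= L ->
  ((Num.sqrt ((s%:num - t%:num) ^+ 2 * (b0 ^+ 2 + b1 ^+ 2)))%:E <=
   HK (dirac_pair (NngNum (P s)) (NngNum (Q s)) y0 y1)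
      (dirac_pair (NngNum (P t)) (NngNum (Q t)) y0 y1))%E.
Proof.
move=> hL.
have h0 (u : {i01 R}) : tcos_mass y0 (dirac_pair (NngNum (P u)) (NngNum (Q u)) y0 y1) = ((1 - u%:num) * b0) ^+ 2.
  by rewrite tcos_mass_two_dirac/= bdistxx tcos0 (bdistC y1) tcos_eq0// expr1n expr0n/= mulr0 addr0 mulr1.
have h1 (u : {i01 R}) : tcos_mass y1 (dirac_pair (NngNum (P u)) (NngNum (Q u)) y0 y1) = (u%:num * b1) ^+ 2.
  by rewrite tcos_mass_two_dirac/= bdistxx tcos0 tcos_eq0// expr1n expr0n/= mulr0 add0r mulr1.
have hm (u : {i01 R}) : mass (dirac_pair (NngNum (P u)) (NngNum (Q u)) y0 y1) =
   ((1 - u%:num) * b0) ^+ 2 + (u%:num * b1) ^+ 2 by rewrite mass_two_dirac.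
have := HK_profile_ge hL (P s) (Q s) (P t) (Q t) (h0 s) (h1 s) (hm s) (h0 t) (h1 t) (hm t).
by congr (_ <= _)%E; congr (Num.sqrt _)%:E; ring.
Qed.

Lemma vertex_pair_upper (s t : {i01 R}) (b0 b1 : R)
    (P : forall u : {i01 R}, 0 <= (1 - u%:num) * b0) (Q : forall u : {i01 R}, 0 <= u%:num * b1) :
  HK2_le (dirac_pair (NngNum (P s)) (NngNum (Q s)) y0 y1)
      (dirac_pair (NngNum (P t)) (NngNum (Q t)) y0 y1)
   ((s%:num - t%:num) ^+ 2 * (b0 ^+ 2 + b1 ^+ 2)).
Proof.
have := HK2_le_dirac_pair (NngNum (P s)) (NngNum (Q s)) (NngNum (P t)) (NngNum (Q t)) y0 y1 y0 y1.
rewrite /= !bdistxx cos_piE ?divr_ge0 ?pi_ge0// cos0.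
by congr HK2_le; ring.
Qed.

Variables (a0 a1 : {posnum R}).
Local Notation r0 := (Num.sqrt a0%:num).
Local Notation r1 := (Num.sqrt a1%:num).

Lemma geodesic_exists : L <> pi / 2 -> exists c, is_geodesic_between y0 y1 a0 a1 c.
Proof.
move=> hL.
have r00 : 0 < r0 by rewrite sqrtr_gt0.
have r10 : 0 < r1 by rewrite sqrtr_gt0.
have r0E : r0 ^+ 2 = a0%:num by rewrite sqr_sqrtr.
have r1E : r1 ^+ 2 = a1%:num by rewrite sqr_sqrtr.
have [L2|L2|//] := ltgtP L (pi / 2).
  have [z [z0 zL zd]] := segment_arc.
  exists (ray r0 r1 z (lexx 0)); split.
  - apply: (@geodesic_intro _ (r0 ^+ 2 + r1 ^+ 2 - 2 * r0 * r1 * cos L)).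
    + have := hk2_point_mass_ge0 y0 y1 a0 a1; rewrite -{1}r0E -{1}r1E tcosE//; exact: ltW.
    + move=> s t; have : HK2_le (ray r0 r1 z (lexx 0) s) (ray r0 r1 z (lexx 0) t)
        ((s%:num - t%:num) ^+ 2 * (0 ^+ 2 + (r0 ^+ 2 + r1 ^+ 2 - 2 * r0 * r1 * cos L))).
        by apply: ray_upper => //; exact: ltW.
      by rewrite expr0n/= add0r.
    + by move=> s t; apply: ray_lower_lt => //; exact: ltW.
  - by move=> A mA; rewrite ray0 ?ltW// point_massE expr0n/= add0r r0E.
  - by move=> A mA; rewrite ray1 ?ltW// point_massE r1E.
(* Beyond pi/2 nothing moves: the atom at [y0] shrinks and the one at [y1] grows, with square roots
   of the masses affine in time. *)
have P (u : {i01 R}) : 0 <= (1 - u%:num) * r0 by exact: onem_i01_ge0 (ltW r00).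
have Q (u : {i01 R}) : 0 <= u%:num * r1 by apply: mulr_ge0 => //; exact: ltW.
exists (fun t => dirac_pair (NngNum (P t)) (NngNum (Q t)) y0 y1); split.
- apply: (@geodesic_intro _ (r0 ^+ 2 + r1 ^+ 2)).
  + by rewrite addr_ge0 ?sqr_ge0.
  + by move=> s t; exact: vertex_pair_upper.
  + by move=> s t; apply: vertex_pair_lower; rewrite ?ltW.
- by move=> A mA; rewrite dirac_pairE/= point_massE subr0 mul1r mul0r expr0n/= mul0r addr0 r0E.
- by move=> A mA; rewrite dirac_pairE/= point_massE subrr mul1r mul0r expr0n/= mul0r add0r r1E.
Qed.

End existence.

(** * The critical distance pi / 2 *)

Section linear.
Context {R : realType} {V : lmodType R}.

Lemma lin_span_range (n : nat) (v : 'I_n -> V) (w : V) : lin_span (range v) w ->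
  exists m : 'I_n -> R, w = \sum_i m i *: v i.
Proof.
move=> [k [u [a [hu ->]]]].
have [f hf] : {f : 'I_k -> 'I_n & forall i, v (f i) = u i}.
  apply: (@choice _ _ (fun i j => v j = u i)) => i.
  by have [j _ ji] := hu i; exists j.
exists (fun j => \sum_(i < k | f i == j) a i).
under [RHS]eq_bigr do rewrite scaler_suml.
rewrite (partition_big f xpredT)//=; apply: eq_bigr => j _.
by apply: eq_bigr => i /eqP <-; rewrite hf.
Qed.

(** If [n] vectors spanned, the coefficients of n + 1 members of [S] would form a matrix with more
    rows than columns; a nonzero row vector of its left kernel is a forbidden linear relation. *)
Lemma lin_indep_infinite_dim (G S : set V) (w : nat -> V) : S `<=` G -> lin_indep S ->
  injective w -> (forall i, S (w i)) -> ~ finite_dim (lin_span G).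
Proof.
move=> SG hS winj hw [n [v hv]].
have hspan i : lin_span (range v) (w i).
  rewrite -hv; exists 1, (fun _ => w i), (fun _ => 1); split.
    by move=> _; exact: SG.
  by rewrite big_ord1 scale1r.
have [m hm] : {m : nat -> 'I_n -> R & forall i, w i = \sum_j m i j *: v j}.
  by apply: (@choice _ _ (fun i m => w i = \sum_j m j *: v j)) => i; exact: lin_span_range.
pose M : 'M[R]_(n.+1, n) := \matrix_(i, j) m i j.
have : kermx M != 0.
  rewrite kermx_eq0 /row_free; apply/negP => /eqP h.
  by have := rank_leq_col M; rewrite h ltnn.
move=> /rowV0Pn[u /sub_kermxP uM u0].
have {}u0 : exists i, u 0 i != 0.
  apply: contrapT => h; move/eqP: u0; apply; apply/rowP => i; rewrite mxE.
  by apply/eqP/negPn/negP => ui; apply: h; exists i.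
have [i /eqP ui] := u0; apply: ui.
apply: (hS n.+1 (fun i : 'I_n.+1 => w i) (fun i => u 0 i)) => //.
  by move=> i1 i2 /winj /val_inj.
transitivity (\sum_j (\sum_(i0 < n.+1) u 0 i0 * M i0 j) *: v j).
  under [RHS]eq_bigr do rewrite scaler_suml.
  rewrite exchange_big/=; apply: eq_bigr => i0 _; rewrite hm scaler_sumr.
  by apply: eq_bigr => j _; rewrite scalerA mxE.
apply: big1 => j _; have := congr1 (fun N : 'rV[R]_n => N 0 j) uM.
by rewrite !mxE => ->; rewrite scale0r.
Qed.

End linear.

Section convexity.
Context {R : realType} {d : nat} {Omega : set 'rV[R]_d} {x0 : Omega}.
Local Notation X := (body x0).
Local Notation fm T := {finite_measure set T -> \bar R}.
Implicit Types (mu nu : fm X).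

Lemma tcos_mass_add y mu nu : tcos_mass y (fmeasure_add mu nu) = tcos_mass y mu + tcos_mass y nu.
Proof.
rewrite /tcos_mass /Rintegral ge0_integral_measure_add//.
- rewrite fineD//; apply: integrable_fin_num => //; exact: tcos2_integrable.
- by move=> x _; rewrite lee_fin sqr_ge0.
- by apply/measurable_EFinP; exact: (continuous_measurable_body (@continuous_tcos2 _ _ _ _ y)).
Qed.

Lemma tcos_mass_mscale y (k : {nonneg R}) mu : tcos_mass y (mscale k mu) = k%:num * tcos_mass y mu.
Proof.
rewrite /tcos_mass /Rintegral ge0_integral_mscale//.
- rewrite fineM//; apply: integrable_fin_num => //; exact: tcos2_integrable.
- by apply/measurable_EFinP; exact: (continuous_measurable_body (@continuous_tcos2 _ _ _ _ y)).
- by move=> x _; rewrite lee_fin sqr_ge0.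
Qed.

Lemma mass_add mu nu : mass (fmeasure_add mu nu) = mass mu + mass nu.
Proof.
transitivity (fine (mu setT + nu setT)%E); first by congr fine; exact: fmeasure_addE.
by rewrite fineD ?fin_num_measure.
Qed.

Lemma mass_mscale (k : {nonneg R}) mu : mass (mscale k mu) = k%:num * mass mu.
Proof.
transitivity (fine (k%:num%:E * mu setT)%E); first by [].
by rewrite fineM ?fin_num_measure.
Qed.

Lemma onem_ge0_i01 (k : {i01 R}) : 0 <= 1 - k%:num.
Proof. by rewrite subr_ge0. Qed.

Lemma i01_ge0 (k : {i01 R}) : 0 <= k%:num. Proof. by []. Qed.

Definition mix (k : {i01 R}) mu nu : fm X :=
  fmeasure_add (mscale (NngNum (i01_ge0 k)) mu) (mscale (NngNum (onem_ge0_i01 k)) nu).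

Lemma mixE k mu nu A : mix k mu nu A = (k%:num%:E * mu A + (1 - k%:num)%:E * nu A)%E.
Proof. exact: fmeasure_addE. Qed.

Lemma signed_mix k mu nu :
  signed (mix k mu nu) = k%:num *: signed mu + (1 - k%:num) *: signed nu.
Proof.
apply: val_inj => /=; apply/funext => A.
change (signed_fun (mix k mu nu) A = k%:num * signed_fun mu A + (1 - k%:num) * signed_fun nu A).
rewrite /signed_fun; case: asboolP => [mA|_]; last by rewrite !mulr0 addr0.
have fmu := fin_num_measure mu A mA; have fnu := fin_num_measure nu A mA.
by rewrite mixE fineD ?fin_numM// !fineM.
Qed.

Lemma tcos_mass_mix y k mu nu : tcos_mass y (mix k mu nu) =
  k%:num * tcos_mass y mu + (1 - k%:num) * tcos_mass y nu.
Proof. by rewrite tcos_mass_add !tcos_mass_mscale. Qed.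

Lemma mass_mix k mu nu : mass (mix k mu nu) = k%:num * mass mu + (1 - k%:num) * mass nu.
Proof. by rewrite mass_add !mass_mscale. Qed.

Lemma HK2_le_mix k mu nu mu' nu' K : HK2_le mu nu K -> HK2_le mu' nu' K ->
  HK2_le (mix k mu mu') (mix k nu nu') K.
Proof.
move=> h h'; have := HK2_le_add (HK2_le_mscale (NngNum (i01_ge0 k)) h)
  (HK2_le_mscale (NngNum (onem_ge0_i01 k)) h').
by congr HK2_le; rewrite -mulrDl/= addrC subrK mul1r.
Qed.

Variables (y0 y1 : X) (a0 a1 : {posnum R}).
Local Notation L := (bdist y0 y1).
Local Notation r0 := (Num.sqrt a0%:num).
Local Notation r1 := (Num.sqrt a1%:num).
Hypothesis LE : L = pi / 2.

Let r0E : r0 ^+ 2 = a0%:num. Proof. by rewrite sqr_sqrtr. Qed.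
Let r1E : r1 ^+ 2 = a1%:num. Proof. by rewrite sqr_sqrtr. Qed.
Let hL : pi / 2 <= L. Proof. by rewrite LE. Qed.
Let hL' : pi / 2 <= bdist y1 y0. Proof. by rewrite bdistC LE. Qed.

(** The values along every geodesic at the critical distance. The conditions are affine in [mu],
    hence preserved by mixing, and strong enough for the lower bound. *)
Definition profile (t : {i01 R}) mu : Prop :=
  [/\ tcos_mass y0 mu = ((1 - t%:num) * r0) ^+ 2,
      tcos_mass y1 mu = (t%:num * r1) ^+ 2
    & mass mu = ((1 - t%:num) * r0) ^+ 2 + (t%:num * r1) ^+ 2].

Lemma profile_lower s t mu nu : profile s mu -> profile t nu ->
  ((Num.sqrt ((s%:num - t%:num) ^+ 2 * (a0%:num + a1%:num)))%:E <= HK mu nu)%E.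
Proof.
move=> [h0 h1 hm] [h0' h1' hm'].
have P0 (u : {i01 R}) : 0 <= (1 - u%:num) * r0 by apply: onem_i01_ge0; exact: sqrtr_ge0.
have Q0 (u : {i01 R}) : 0 <= u%:num * r1 by apply: mulr_ge0 => //; exact: sqrtr_ge0.
have := HK_profile_ge hL (P0 s) (Q0 s) (P0 t) (Q0 t) h0 h1 hm h0' h1' hm'.
by congr (_ <= _)%E; congr (Num.sqrt _)%:E; rewrite -[X in _ * (X + _)]r0E -[X in _ * (_ + X)]r1E; ring.
Qed.

Lemma profile_mix k t mu nu : profile t mu -> profile t nu -> profile t (mix k mu nu).
Proof.
move=> [h0 h1 hm] [h0' h1' hm']; split.
- by rewrite tcos_mass_mix h0 h0'; ring.
- by rewrite tcos_mass_mix h1 h1'; ring.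
- by rewrite mass_mix hm hm'; ring.
Qed.

Lemma geodesic_profile c t : is_geodesic_between y0 y1 a0 a1 c -> profile t (c t).
Proof.
move=> gc; have [_ c0 c1] := gc.
have pm (a : {posnum R}) y A : point_mass a y A = two_dirac (NngNum (ge0 a)) (NngNum (lexx 0)) y y A.
  by rewrite point_massE two_diracE/= mul0r addr0.
have [t0|t0] := eqVneq t%:num 0.
  have E A : measurable A -> c t A = two_dirac (NngNum (ge0 a0)) (NngNum (lexx 0)) y0 y0 A.
    by move=> mA; rewrite -pm -c0//; congr (c _ A); apply: val_inj.
  rewrite /profile (mass_eq E) !(tcos_mass_eq _ E) !tcos_mass_two_dirac mass_two_dirac/=.
  rewrite bdistxx tcos0 (tcos_eq0 hL) t0 subr0 !mul0r mul1r r0E expr1n expr0n/=.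
  by rewrite mulr1 mulr0 !addr0.
have [t1|t1] := eqVneq t%:num 1.
  have E A : measurable A -> c t A = two_dirac (NngNum (ge0 a1)) (NngNum (lexx 0)) y1 y1 A.
    by move=> mA; rewrite -pm -c1//; congr (c _ A); apply: val_inj.
  rewrite /profile (mass_eq E) !(tcos_mass_eq _ E) !tcos_mass_two_dirac mass_two_dirac/=.
  rewrite bdistxx tcos0 (tcos_eq0 hL') t1 subrr !mul0r mul1r r1E expr1n expr0n/=.
  by rewrite mulr1 mulr0 !addr0 add0r.
have t01 : 0 < t%:num < 1.
  by rewrite lt_neqAle eq_sym t0 lt_neqAle t1/= ge0 le1.
have [h0 h1] := geodesic_point gc t01.
rewrite Rintegral_qform; move: h0 h1; rewrite (tcos_eq0 hL) !mulr0 !addr0 => h0 h1.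
rewrite h0 h1 => h; split => //.
have /andP[t0' t1'] := t01.
(* Here u = p and v = q, so the vanishing gap integral is p q times (mass - [C_0] - [C_1]);
   cancelling p q gives the mass. *)
have pq : (1 - t%:num) * r0 * (t%:num * r1) != 0.
  by rewrite gt_eqF// !mulr_gt0 ?subr_gt0 ?sqrtr_gt0.
by apply: (mulfI pq); lra.
Qed.

Let K : R := a0%:num + a1%:num.

Lemma geodesic_upper c s t : is_geodesic_between y0 y1 a0 a1 c ->
  HK2_le (c s) (c t) ((s%:num - t%:num) ^+ 2 * K).
Proof.
move=> gc; have K0 : 0 <= K by rewrite addr_ge0.
apply/HK2_leP; first by rewrite mulr_ge0 ?sqr_ge0.
have [D [D0 DK ->]] := geodesic_speed gc.
rewrite lee_fin sqrtrM ?sqr_ge0// sqrtr_sqr ler_wpM2l//.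
rewrite -[leLHS](ger0_norm D0) -sqrtr_sqr ler_wsqrtr//.
by move: DK; rewrite (tcos_eq0 hL) mulr0 subr0.
Qed.

Lemma geodesic_mix k c c' : is_geodesic_between y0 y1 a0 a1 c ->
  is_geodesic_between y0 y1 a0 a1 c' ->
  is_geodesic_between y0 y1 a0 a1 (fun t => mix k (c t) (c' t)).
Proof.
move=> gc gc'; have [_ c0 c1] := gc; have [_ c0' c1'] := gc'.
have E (e : \bar R) : e \is a fin_num -> (k%:num%:E * e + (1 - k%:num)%:E * e)%E = e.
  by move=> /fineK <-; rewrite -!EFinM -EFinD -mulrDl addrC subrK mul1r.
split.
- apply: (@geodesic_intro _ _ _ _ _ K).
  + by rewrite addr_ge0.
  + by move=> s t; apply: HK2_le_mix; exact: geodesic_upper.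
  + by move=> s t; apply: profile_lower; apply: profile_mix; exact: geodesic_profile.
- by move=> A mA; rewrite mixE c0// c0'// E// point_massE.
- by move=> A mA; rewrite mixE c1// c1'// E// point_massE.
Qed.

Lemma geodesics_betweenP (w : curve (x0 := x0)) :
  geodesics_between (point_mass a0 y0) (point_mass a1 y1) w <->
  exists2 c, is_geodesic_between y0 y1 a0 a1 c & w = (fun t => signed (c t)).
Proof.
split => [[c [gc /signed_eqP c0 /signed_eqP c1] <-]|[c [gc c0 c1] ->]].
  by exists c.
by exists c => //; split => //; apply/signed_eqP.
Qed.

Lemma convex_geodesics :
  convex_set (geodesics_between (point_mass a0 y0) (point_mass a1 y1)).
Proof.
move=> w w' k /set_mem/geodesics_betweenP[c gc ->] /set_mem/geodesics_betweenP[c' gc' ->].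
apply/mem_set/geodesics_betweenP; exists (fun t => mix k (c t) (c' t)).
  exact: geodesic_mix.
by apply/funext => t; rewrite signed_mix.
Qed.

End convexity.

Lemma uncountable_itv01 {R : realType} : ~ countable (`]0, 1[%classic : set R).
Proof.
move=> /countable_lebesgue_measure0; rewrite lebesgue_measure_itv/= lte_fin ltr01.
by rewrite sube0 => /eqP; rewrite eqe oner_eq0.
Qed.

Section family.
Context {R : realType} {d : nat} {Omega : set 'rV[R]_d} {x0 : Omega}.
Local Notation X := (body x0).
Local Notation fm T := {finite_measure set T -> \bar R}.
Variables (y0 y1 : X) (a0 a1 : {posnum R}) (z : R -> X).
Local Notation L := (bdist y0 y1).
Local Notation r1 := (Num.sqrt a1%:num).
Hypothesis LE : L = pi / 2.
Hypothesis z0 : z 0 = y0.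
Hypothesis zL : z L = y1.
Hypothesis zdist : forall a b, 0 <= a <= L -> 0 <= b <= L -> bdist (z a) (z b) = `|a - b|.

Let L2 : L <= pi / 2. Proof. by rewrite LE. Qed.
Let L02 : 0 <= L <= pi / 2. Proof. by rewrite bdist_ge0 L2. Qed.
Let r1_gt0 : 0 < r1. Proof. by rewrite sqrtr_gt0. Qed.
Let r1E : r1 ^+ 2 = a1%:num. Proof. by rewrite sqr_sqrtr. Qed.

(* A fraction [theta] of the mass at [y0] travels to [y1]; the rest goes to the vertex. *)
Definition split_curve (theta : R) : {i01 R} -> fm X :=
  ray y0 y1 (Num.sqrt (theta * a0%:num)) r1 z (sqrtr_ge0 ((1 - theta) * a0%:num)).

Lemma half_ge0 : 0 <= 1 / 2 :> R. Proof. by rewrite divr_ge0. Qed.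
Lemma half_le1 : 1 / 2 <= 1 :> R. Proof. by lra. Qed.
Definition half01 : {i01 R} := Itv01 half_ge0 half_le1.

Lemma split_curve_geodesic theta : 0 < theta < 1 ->
  is_geodesic_between y0 y1 a0 a1 (split_curve theta).
Proof.
move=> /andP[th0 th1].
have b0 : 0 < Num.sqrt (theta * a0%:num) by rewrite sqrtr_gt0 mulr_gt0.
have b0E : Num.sqrt (theta * a0%:num) ^+ 2 = theta * a0%:num.
  by rewrite sqr_sqrtr// mulr_ge0// ltW.
have eE : Num.sqrt ((1 - theta) * a0%:num) ^+ 2 = (1 - theta) * a0%:num.
  by rewrite sqr_sqrtr// mulr_ge0// subr_ge0 ltW.
split.
- apply: (@geodesic_intro _ _ _ _ _ (a0%:num + a1%:num)).
  + by rewrite addr_ge0.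
  + move=> s t.
    have := ray_upper (sqrtr_ge0 ((1 - theta) * a0%:num)) b0 r1_gt0 L2 zdist s t.
    rewrite -/(split_curve theta s) -/(split_curve theta t) b0E eE r1E LE cos_pihalf.
    by congr HK2_le; ring.
  + move=> s t.
    have := ray_lower_eq (sqrtr_ge0 ((1 - theta) * a0%:num)) b0 r1_gt0 L2 z0 zL zdist s t LE.
    rewrite -/(split_curve theta s) -/(split_curve theta t) b0E eE r1E.
    by congr (_ <= _)%E; congr (Num.sqrt _)%:E; ring.
- by move=> A mA; rewrite /split_curve ray0// point_massE eE b0E -mulrDl subrK mul1r.
- by move=> A mA; rewrite /split_curve ray1// point_massE r1E.
Qed.

Definition split_angle (theta : R) : R := planarA L (Num.sqrt (theta * a0%:num)) r1 (1 / 2).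
Definition split_radius (theta : R) : R := planarR L (Num.sqrt (theta * a0%:num)) r1 (1 / 2).

Section half.
Variable theta : R.
Hypothesis theta01 : 0 < theta < 1.

Let b0 : 0 < Num.sqrt (theta * a0%:num).
Proof. by move/andP: theta01 => [? ?]; rewrite sqrtr_gt0 mulr_gt0. Qed.

Let half_itv : 0 <= (1 / 2 : R) <= 1. Proof. by rewrite half_ge0 half_le1. Qed.

Lemma split_angle_itv : 0 <= split_angle theta <= L.
Proof. exact: planarA_itv. Qed.

Lemma split_radius_gt0 : 0 < split_radius theta.
Proof. exact: planarR_gt0. Qed.

Lemma split_cos : split_radius theta * cos (split_angle theta) =
  1 / 2 * Num.sqrt (theta * a0%:num).
Proof. by rewrite planarX_cos// /planarX LE cos_pihalf mulr0 addr0; lra. Qed.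

Lemma split_sin : split_radius theta * sin (split_angle theta) = 1 / 2 * r1.
Proof. by rewrite planarY_sin// /planarY LE sin_pihalf mulr1. Qed.

Lemma split_sin_neq0 : sin (split_angle theta) != 0.
Proof.
apply/eqP => h; have := split_sin; rewrite h mulr0; have := r1_gt0; lra.
Qed.

End half.

(** The vertical coordinate R sin A = r1 / 2 does not depend on [theta], so the angle determines the
    radius; the horizontal coordinate then gives [theta]. *)
Lemma split_angle_inj theta theta' : 0 < theta < 1 -> 0 < theta' < 1 ->
  split_angle theta = split_angle theta' -> theta = theta'.
Proof.
move=> h h' hA.
have hR : split_radius theta = split_radius theta'.
  apply: (mulIf (split_sin_neq0 h)).
  by rewrite (split_sin h) hA (split_sin h').
have := split_cos h; rewrite hR hA (split_cos h') => hb.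
have /andP[t0 _] := h; have /andP[t0' _] := h'.
have {}hb : Num.sqrt (theta' * a0%:num) = Num.sqrt (theta * a0%:num) by lra.
have := congr1 (fun u => u ^+ 2) hb; rewrite /= !sqr_sqrtr ?mulr_ge0 ?ltW//.
by move=> /mulIf => /(_ _)/esym; apply.
Qed.

Definition split_point (theta : R) : X := z (split_angle theta).

Lemma split_point_inj theta theta' : 0 < theta < 1 -> 0 < theta' < 1 ->
  split_point theta = split_point theta' -> theta = theta'.
Proof.
move=> h h' hz; apply: split_angle_inj => //.
have := zdist (split_angle_itv h) (split_angle_itv h').
rewrite -/(split_point theta) -/(split_point theta') hz bdistxx => /esym/normr0_eq0.
by move=> /subr0_eq.
Qed.

Lemma split_point_neq theta : 0 < theta < 1 -> split_point theta <> y0.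
Proof.
move=> h hz.
have := zdist (split_angle_itv h) (_ : 0 <= 0 <= L).
rewrite z0 -/(split_point theta) hz bdistxx subr0 lexx bdist_ge0 => /(_ isT)/esym/normr0_eq0 hA.
by have := split_sin_neq0 h; rewrite hA sin0 eqxx.
Qed.

Definition split_signed (theta : R) : curve (x0 := x0) := fun t => signed (split_curve theta t).

(* At time [1/2] the travelling mass sits at a point depending injectively on [theta]. *)
Definition half_mass (x : X) (w : curve (x0 := x0)) : R := (w half01 : set X -> R) [set x].

(** The functionals [half_mass] at the split points are biorthogonal, up to positive factors, to the
    curves of the family. Injectivity and linear independence both follow. *)
Lemma half_mass_split theta theta' : 0 < theta < 1 -> 0 < theta' < 1 ->
  half_mass (split_point theta') (split_signed theta) =
  if theta == theta' then split_radius theta ^+ 2 else 0.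
Proof.
move=> h h'; rewrite /half_mass /split_signed /= /signed_fun asboolT; last exact: measurable_singleton.
rewrite /split_curve /ray dirac_pairE/= -/(split_angle theta) -/(split_radius theta) -/(split_point theta).
rewrite (memNset (_ : ~ [set split_point theta'] y0)); last first.
  by move=> /esym/(split_point_neq h').
rewrite mulr0 add0r; case: eqVneq => [->|tn]; first by rewrite mem_set// mulr1.
rewrite memNset ?mulr0// => /(split_point_inj h h') E.
by rewrite E eqxx in tn.
Qed.

Lemma half_mass_sum x n (a : 'I_n -> R) (v : 'I_n -> curve (x0 := x0)) :
  half_mass x (\sum_i a i *: v i) = \sum_i a i * half_mass x (v i).
Proof.
exact: (big_morph (half_mass x) (id1 := 0) (op1 := +%R)).
Qed.

Definition split_family : set (curve (x0 := x0)) :=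
  [set split_signed theta | theta in `]0, 1[%classic].

Let itvP (theta : R) : `]0, 1[%classic theta -> 0 < theta < 1.
Proof. by rewrite /= in_itv. Qed.

Lemma split_signed_inj theta theta' : 0 < theta < 1 -> 0 < theta' < 1 ->
  split_signed theta = split_signed theta' -> theta = theta'.
Proof.
move=> h h' E; apply/esym/eqP; have := half_mass_split h' h; rewrite -E half_mass_split//.
rewrite eqxx; case: eqP => // _ /eqP; rewrite sqrf_eq0.
by rewrite (gt_eqF (split_radius_gt0 h)).
Qed.

Lemma split_family_geodesics :
  split_family `<=` geodesics_between (point_mass a0 y0) (point_mass a1 y1).
Proof.
move=> _ [theta /itvP h <-]; apply/geodesics_betweenP.
by exists (split_curve theta) => //; exact: split_curve_geodesic.
Qed.

Lemma split_family_uncountable : ~ countable split_family.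
Proof.
move=> /countable_injP[f finj]; apply: (@uncountable_itv01 R).
apply/countable_injP; exists (f \o split_signed) => t t' /set_mem ht /set_mem ht' /=.
move=> /finj E; apply: split_signed_inj; [exact: itvP|exact: itvP|].
by apply: E; apply/mem_set; [exists t|exists t'].
Qed.

Lemma split_family_indep : lin_indep split_family.
Proof.
move=> n v a vinj hS hsum i.
have [th hth] : {th : 'I_n -> R & forall i, 0 < th i < 1 /\ split_signed (th i) = v i}.
  apply: (@choice _ _ (fun i th => 0 < th < 1 /\ split_signed th = v i)) => j.
  by have [t /itvP ht E] := hS j; exists t.
have := congr1 (half_mass (split_point (th i))) hsum.
rewrite half_mass_sum (bigD1 i)//= big1 ?addr0; last first.
  move=> j ji; have [hj <-] := hth j; have [hi _] := hth i.
  rewrite half_mass_split//; case: eqP => [E|_]; last by rewrite mulr0.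
  have : v i = v j by rewrite -(hth i).2 -(hth j).2 E.
  by move=> /vinj ij; rewrite ij eqxx in ji.
have [hi <-] := hth i; rewrite half_mass_split// eqxx => /eqP.
rewrite (_ : half_mass _ 0 = 0)// mulf_eq0 sqrf_eq0 (gt_eqF (split_radius_gt0 hi)) orbF.
by move=> /eqP.
Qed.

Lemma geodesics_infinite_dim :
  ~ finite_dim (lin_span (geodesics_between (point_mass a0 y0) (point_mass a1 y1))).
Proof.
(* The sequence starts at 1/2 so that all parameters lie strictly between 0 and 1. *)
have th (n : nat) : 0 < (n.+2%:R : R)^-1 < 1.
  by rewrite invr_gt0 ltr0n/= invf_lt1 ?ltr0n// ltr1n.
apply: (lin_indep_infinite_dim (w := fun n => split_signed (n.+2%:R)^-1)
  split_family_geodesics split_family_indep).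
  move=> n m /(split_signed_inj (th n) (th m))/invr_inj/eqP.
  by rewrite eqr_nat => /eqP[].
by move=> n; exists (n.+2%:R)^-1 => //=; rewrite in_itv/=.
Qed.

End family.

Theorem mainTheorem13 (R : realType) (d : nat) (Omega : set 'rV[R]_d)
    (Omega_convex : convex_set Omega) (Omega_compact : compact Omega)
    (y0 y1 : Omega) (a0 a1 : {posnum R}) :
  let G := geodesics_between (x0 := y0) (point_mass a0 y0) (point_mass a1 y1) in
  (euclid_dist (val y0) (val y1) <> pi / 2 -> exists! c, G c) /\
  (euclid_dist (val y0) (val y1) = pi / 2 ->
    [/\ convex_set G,
        exists S : set curve, [/\ S `<=` G, ~ countable S & lin_indep S]
      & ~ finite_dim (lin_span G)]).
Proof.
move=> G.
split => [hL|LE].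
  have [c gc] := @geodesic_exists R d Omega y0 Omega_convex y0 y1 a0 a1 hL.
  exists (fun t => signed (c t)); split; first by apply/geodesics_betweenP; exists c.
  move=> _ /geodesics_betweenP[c' gc' ->]; apply/funext => t.
  by apply/signed_eqP => A mA; exact: (geodesic_unique t hL gc gc' mA).
have [z [z0 zL zd]] := @segment_arc R d Omega y0 Omega_convex y0 y1.
split.
- exact: (@convex_geodesics R d Omega y0 y0 y1 a0 a1 LE).
- exists (split_family (y0 : body y0) y1 a0 a1 z); split.
  + exact: split_family_geodesics.
  + exact: split_family_uncountable.
  + exact: split_family_indep.
- exact: geodesics_infinite_dim LE z0 zL zd.
Qed.
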